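(* There does not exist a unique factorization domain $R$ of finite character and of Krull dimension $2$ such that the polynomial ring $R[X]$ is radically finite.
   Context: All rings are commutative with identity. A ring $R$ is of finite character if every nonzero element of $R$ is contained in only finitely many maximal ideals. An ideal $I$ of a ring $S$ is called radically perfect if $\mathrm{ht}(I)=\inf\{n \mid \sqrt{I}=\sqrt{(\theta_1,\dots,\theta_n)} \text{ for some } \theta_1,\dots,\theta_n\in S\}$, and moreover, if $\mathrm{ht}(I)=0$, then $\sqrt{I}=\sqrt{(\theta)}$ for some zero divisor $\theta$ of $S$. A ring $S$ is called radically finite if every prime ideal $P$ of $S$ is radically perfect and, in addition, the set of ideals of $S$ that are generated by $\mathrm{ht}(P)$ elements and have radical $P$ has a maximal member $A$ such that there are only finitely many ideals in any chain of ideals between $A$ and $P$. *)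

(* Defs.v *)
From HB Require Import structures.
From mathcomp Require Import all_boot all_order all_algebra.
Set Implicit Arguments.
Unset Strict Implicit.
Unset Printing Implicit Defensive.
Import GRing.Theory.
Local Open Scope ring_scope.

Section Ideals.
Variable S : comNzRingType.

Definition subI (I J : S -> Prop) := forall x, I x -> J x.
Definition eqI (I J : S -> Prop) := forall x, I x <-> J x.

Definition is_ideal (I : S -> Prop) :=
  I 0 /\ (forall x y, I x -> I y -> I (x + y)) /\ (forall a x, I x -> I (a * x)).

Definition is_prime (P : S -> Prop) :=
  is_ideal P /\ ~ P 1 /\ (forall x y, P (x * y) -> P x \/ P y).

Definition is_maximal (M : S -> Prop) :=
  is_ideal M /\ ~ M 1 /\
  (forall J, is_ideal J -> subI M J -> eqI J M \/ J 1).

Definition rad (I : S -> Prop) (x : S) := exists n : nat, I (x ^+ n).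

Definition gen (n : nat) (th : 'I_n -> S) (x : S) :=
  exists c : 'I_n -> S, x = \sum_(i < n) c i * th i.

Definition prime_chain_to (P : S -> Prop) (n : nat) :=
  exists f : nat -> (S -> Prop),
    (forall i, (i <= n)%N -> is_prime (f i)) /\
    (forall i, (i < n)%N -> subI (f i) (f i.+1) /\ ~ subI (f i.+1) (f i)) /\
    eqI (f n) P.

(* ht(I) >= n  (ht(I) = inf of heights of primes containing I, in N u {oo}) *)
Definition ht_ge (I : S -> Prop) (n : nat) :=
  forall Q, is_prime Q -> subI I Q -> prime_chain_to Q n.

Definition ht_is (I : S -> Prop) (n : nat) := ht_ge I n /\ ~ ht_ge I n.+1.

Definition rad_gen_by (I : S -> Prop) (n : nat) :=
  exists th : 'I_n -> S, eqI (rad I) (rad (gen th)).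

Definition zero_divisor (x : S) := exists y : S, y != 0 /\ x * y = 0.

(* ht(I) = inf {n | rad_gen_by I n} as elements of N u {oo}: expressed as
   "both sides have the same natural lower bounds". *)
Definition radically_perfect (I : S -> Prop) :=
  (forall n : nat, ht_ge I n <-> (forall m, (m < n)%N -> ~ rad_gen_by I m)) /\
  (~ ht_ge I 1 ->
     exists th : S, zero_divisor th /\
       eqI (rad I) (rad (gen (fun _ : 'I_1 => th)))).

Definition finite_ideals (C : (S -> Prop) -> Prop) :=
  exists l : seq (S -> Prop), forall J, C J -> exists2 i, (i < size l)%N & eqI J (nth (fun _ => False) l i).

Definition gen_with_rad (P : S -> Prop) (n : nat) (A : S -> Prop) :=
  is_ideal A /\ (exists th : 'I_n -> S, eqI A (gen th)) /\ eqI (rad A) P.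

Definition radically_finite :=
  forall P, is_prime P ->
    radically_perfect P /\
    (forall n, ht_is P n ->
       exists A, gen_with_rad P n A /\
         (forall B, gen_with_rad P n B -> subI A B -> eqI B A) /\
         (forall C : (S -> Prop) -> Prop,
            (forall J, C J -> is_ideal J /\ subI A J /\ subI J P) ->
            (forall J K, C J -> C K -> subI J K \/ subI K J) ->
            finite_ideals C)).

Definition finite_character :=
  forall x : S, x != 0 -> finite_ideals (fun M => is_maximal M /\ M x).

Definition krull_dim_is (n : nat) :=
  (exists P, prime_chain_to P n) /\ ~ (exists P, prime_chain_to P n.+1).

End Ideals.

Section UFD.
Variable R : idomainType.

Definition irreducible_elt (a : R) :=
  a != 0 /\ a \isn't a GRing.unit /\
  (forall b c, a = b * c -> b \is a GRing.unit \/ c \is a GRing.unit).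

Definition associated_elt (a b : R) := exists u, u \is a GRing.unit /\ a = u * b.

Definition is_ufd :=
  (forall x : R, x != 0 -> x \isn't a GRing.unit ->
     exists s : seq R, (forall a, a \in s -> irreducible_elt a) /\
                       x = \prod_(a <- s) a) /\
  (forall s t : seq R,
     (forall a, a \in s -> irreducible_elt a) ->
     (forall a, a \in t -> irreducible_elt a) ->
     \prod_(a <- s) a = \prod_(a <- t) a ->
     exists t', perm_eq t t' /\ size s = size t' /\
       forall i, (i < size s)%N -> associated_elt (nth 0 s i) (nth 0 t' i)).

End UFD.

(* Main.v *)
(** Suppose that [R[X]] is radically finite and let [M] be a maximal ideal of
[R] of height 2. Finite character and dimension 2 make [M] the radical of two
elements, so [M[X]] has height exactly 2 and there are [f], [g] with [M[X]/(f, g)]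
of finite length; hence [M] is generated by two elements [a], [b] locally at
[M], and these can be taken to be prime elements.

The cusp [b^3 - a^4] is then irreducible locally at [M]; let [p] be its prime
factor in [M]. The kernel [P] of [R[X] -> Frac(R/p)], [X |-> b^2/a], is a prime of
height 2 (the space curve [(t^3, t^4, t^5)]). It contains the quadrics
[a X - b^2], [b X - a^3], [X^2 - a^2 b], which are independent modulo the cube of
[N = (M, X)], and it lies in the square of [N], so it is not generated by two
elements locally at [N]. On the other hand if [P = rad (f, g)] with [P/(f, g)] of finite
length, then [f] and [g] are coprime, so [(f, g)] is unmixed and [P = (f, g)]
locally at [N]. *)
Require Import Defs.
From HB Require Import structures.
From mathcomp Require Import all_boot all_order all_algebra.
From mathcomp Require Import boolp classical_sets.
From mathcomp Require Import ring.
Set Implicit Arguments.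
Unset Strict Implicit.
Unset Printing Implicit Defensive.
Import GRing.Theory.
Local Open Scope ring_scope.

(** * Ideals and primes of a commutative ring; existence of primes by Zorn's lemma *)

Section IdealFacts.
Variable S : comNzRingType.
Implicit Types (I J M P Q A : S -> Prop) (x y z : S).

Section Closure.
Variables (I : S -> Prop) (idI : is_ideal I).

Lemma ideal0 : I 0. Proof. by case: idI. Qed.
Lemma idealD x y : I x -> I y -> I (x + y).
Proof. by case: idI => _ [+ _]; apply. Qed.
Lemma idealMl x y : I y -> I (x * y).
Proof. by case: idI => _ [_]; apply. Qed.
Lemma idealMr x y : I x -> I (x * y).
Proof. by rewrite mulrC; apply: idealMl. Qed.
Lemma idealN x : I x -> I (- x).
Proof. by rewrite -mulN1r; apply: idealMl. Qed.
Lemma idealB x y : I x -> I y -> I (x - y).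
Proof. by move=> Ix /idealN; apply: idealD. Qed.
Lemma ideal_addKr x y : I x -> I (x + y) -> I y.
Proof. by move=> Ix /idealB/(_ Ix); rewrite addrAC subrr add0r. Qed.
Lemma ideal_sum (T : Type) (r : seq T) (p : pred T) (F : T -> S) :
  (forall i, p i -> I (F i)) -> I (\sum_(i <- r | p i) F i).
Proof. by move=> IF; apply: big_rec => [|i x pi Ix]; [exact: ideal0|apply: idealD; auto]. Qed.
End Closure.

Lemma prime_ideal P : is_prime P -> is_ideal P. Proof. by case. Qed.
Hint Resolve prime_ideal : core.

Section PrimeClosure.
Variables (P : S -> Prop) (prP : is_prime P).

Lemma prime1 : ~ P 1. Proof. by case: prP => _ []. Qed.
Lemma primeM x y : P (x * y) -> P x \/ P y.
Proof. by case: prP => _ [_]; apply. Qed.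
Lemma primeMl x y : ~ P x -> P (x * y) -> P y.
Proof. by move=> nx /primeM[]. Qed.
Lemma primeNM x y : ~ P x -> ~ P y -> ~ P (x * y).
Proof. by move=> nx ny /primeM[]. Qed.
Lemma primeX x n : P (x ^+ n) -> P x.
Proof. by elim: n => [/prime1//|n IHn]; rewrite exprS => /primeM[]. Qed.
Lemma prime_NX x n : ~ P x -> ~ P (x ^+ n).
Proof. by move=> nx /primeX. Qed.
End PrimeClosure.

Lemma prime_prod P (s : seq S) : is_prime P -> P (\prod_(a <- s) a) ->
  exists2 a, a \in s & P a.
Proof.
move=> prP; elim: s => [|a s IHs]; first by rewrite big_nil => /(prime1 prP).
rewrite big_cons => /(primeM prP)[Pa|/IHs[b bs Pb]].
  by exists a; rewrite ?mem_head.
by exists b; rewrite // inE bs orbT.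
Qed.

Lemma gen_ideal n (th : 'I_n -> S) : is_ideal (gen th).
Proof.
split; first by exists (fun=> 0); rewrite big1 // => i _; rewrite mul0r.
split=> [_ _ [c ->] [d ->]|a _ [c ->]].
  by exists (fun i => c i + d i); rewrite -big_split; apply: eq_bigr => i _; rewrite mulrDl.
by exists (fun i => a * c i); rewrite mulr_sumr; apply: eq_bigr => i _; rewrite mulrA.
Qed.

Lemma gen_mem n (th : 'I_n -> S) i : gen th (th i).
Proof.
exists (fun j => (j == i)%:R); rewrite (bigD1 i) //= eqxx mul1r big1 ?addr0 //.
by move=> j /negPf ->; rewrite mul0r.
Qed.

Lemma gen_min n (th : 'I_n -> S) I : is_ideal I -> (forall i, I (th i)) -> subI (gen th) I.
Proof. by move=> idI Ith _ [c ->]; apply: ideal_sum => // i _; apply: idealMl. Qed.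

Lemma gen2E (th : 'I_2 -> S) x :
  gen th x <-> exists u v, x = u * th ord0 + v * th (lift ord0 ord0).
Proof.
have idg := gen_ideal th; split=> [[c ->]|[u [v ->]]]; last first.
  by apply: (idealD idg); apply: (idealMl idg); exact: gen_mem.
by exists (c ord0), (c (lift ord0 ord0)); rewrite !big_ord_recl big_ord0 addr0.
Qed.

Definition adjoin I x z := exists i c, I i /\ z = i + c * x.

Lemma adjoin_ideal I x : is_ideal I -> is_ideal (adjoin I x).
Proof.
move=> idI; split.
  by exists 0, 0; split; [exact: ideal0|rewrite mul0r addr0].
split=> [_ _ [i [c [Ii ->]]] [j [d [Ij ->]]]|a _ [i [c [Ii ->]]]].
  by exists (i + j), (c + d); split; [exact: idealD|ring].
by exists (a * i), (a * c); split; [exact: idealMl|ring].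
Qed.

Lemma adjoin_sub I x : subI I (adjoin I x).
Proof. by move=> z Iz; exists z, 0; rewrite mul0r addr0. Qed.

Lemma adjoin_mem I x : is_ideal I -> adjoin I x x.
Proof. by move=> idI; exists 0, 1; rewrite mul1r add0r; split=> //; exact: ideal0. Qed.

Section Krull.
Variables (I : S -> Prop) (T : S -> Prop).
Hypotheses (idI : is_ideal I) (IT : forall x, I x -> ~ T x).

Lemma exists_maximal_avoiding : exists Q, [/\ is_ideal Q, subI I Q,
  (forall x, Q x -> ~ T x) &
  forall J, is_ideal J -> subI Q J -> (forall x, J x -> ~ T x) -> subI J Q].
Proof.
pose good (J : set S) := [/\ is_ideal J, subI I J & forall x, J x -> ~ T x].
have [|A [PA maxA]] := @Zorn_bigcup S (fun J => J = set0 \/ good J).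
  move=> F PF totF.
  have [[J0 [FJ0 gJ0]]|noJ] := pselect (exists J, F J /\ good J); last first.
    left; rewrite predeqE => x; split=> // -[J FJ Jx].
    by case: (PF _ FJ) => [JE|gJ]; [rewrite JE in Jx|case: noJ; exists J].
  right; split.
  - split; first by exists J0 => //; case: gJ0 => /ideal0.
    split=> [x y [J FJ Jx] [K FK Ky]|a x [J FJ Jx]].
      have [JK|KJ] := totF _ _ FJ FK.
        exists K => //; case: (PF _ FK) => [KE|[idK _ _]]; first by rewrite KE in Ky.
        by apply: idealD => //; exact: JK.
      exists J => //; case: (PF _ FJ) => [JE|[idJ _ _]]; first by rewrite JE in Jx.
      by apply: idealD => //; exact: KJ.
    exists J => //; case: (PF _ FJ) => [JE|[idJ _ _]]; first by rewrite JE in Jx.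
    exact: idealMl.
  - by move=> x Ix; exists J0 => //; case: gJ0 => _ + _; apply.
  - move=> x [J FJ Jx]; case: (PF _ FJ) => [JE|[_ _]]; first by rewrite JE in Jx.
    exact.
case: PA => [A0|[idA IA AT]].
  case: (maxA I); last by right; split.
  rewrite A0; split=> [x []//|/(_ 0) []]; exact: ideal0.
exists A; split=> // J idJ AJ JT; apply: contrapT => nJA.
by case: (maxA J); [split|right; split=> // x /IA /AJ].
Qed.

End Krull.

(** An ideal maximal among those containing [I] and avoiding the powers of [x] is prime: enlarged by
    [y] or by [z] it meets these powers, and multiplying the two powers obtained would put a power
    of [x] into it if [y * z] were there. *)
Lemma exists_prime_avoiding I x : is_ideal I -> ~ Defs.rad I x ->
  exists Q, [/\ is_prime Q, subI I Q & ~ Q x].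
Proof.
move=> idI nIx.
have [|Q [idQ IQ QT maxQ]] := @exists_maximal_avoiding I (fun z => exists n, z = x ^+ n) idI.
  by move=> z Iz [n zE]; apply: nIx; exists n; rewrite -zE.
exists Q; split=> //; last by move=> /QT; apply; exists 1%N.
split=> //; split=> [/QT|y z Qyz]; first by apply; exists 0%N.
have adj w : ~ Q w -> exists n, adjoin Q w (x ^+ n).
  move=> nQw; apply: contrapT => nadj; apply: nQw; apply: (maxQ (adjoin Q w)).
  - exact: adjoin_ideal.
  - exact: adjoin_sub.
  - by move=> v av [n vE]; apply: nadj; exists n; rewrite -vE.
  - exact: adjoin_mem.
apply: contrapT => /not_orP[/adj[n [i [c [Qi iE]]]] /adj[m [j [d [Qj jE]]]]].
apply: (QT (x ^+ (n + m))); last by exists (n + m)%N.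
rewrite exprD iE jE.
have -> : (i + c * y) * (j + d * z) = i * (j + d * z) + (c * y * j + c * d * (y * z)) by ring.
by apply: idealD => //; [apply: idealMr|apply: idealD => //; apply: idealMl].
Qed.

Lemma maximal_prime M : is_maximal M -> is_prime M.
Proof.
move=> [idM [M1 maxM]]; split=> //; split=> // x y Mxy.
apply: contrapT => /not_orP[nx ny].
have [EM|[i [c [Mi E1]]]] := maxM _ (adjoin_ideal x idM) (@adjoin_sub M x).
  by apply/nx/EM/adjoin_mem.
apply: ny; rewrite -[y]mul1r E1 mulrDl -mulrA.
by apply: idealD => //; [apply: idealMr|apply: idealMl].
Qed.

Lemma exists_maximal I : is_ideal I -> ~ I 1 ->
  exists2 M, is_maximal M & subI I M.
Proof.
move=> idI nI1.
have [|Q [idQ IQ QT maxQ]] := @exists_maximal_avoiding I (fun z => z = 1) idI.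
  by move=> z + zE; rewrite zE.
exists Q => //; split=> //; split=> [/QT|J idJ QJ]; first exact.
have [J1|nJ1] := pselect (J 1); [by right|left=> x; split; last exact: QJ].
by apply: maxQ => // z + zE; rewrite zE.
Qed.

(* A chain of sums [A + (z ^+ n * h)], being finite, repeats. *)
Lemma finite_chain_power A P z h : is_ideal A -> is_ideal P -> subI A P -> P h ->
  (forall C : (S -> Prop) -> Prop,
     (forall J, C J -> is_ideal J /\ subI A J /\ subI J P) ->
     (forall J K, C J -> C K -> subI J K \/ subI K J) -> finite_ideals C) ->
  exists n w, A ((1 - z * w) * (z ^+ n * h)).
Proof.
move=> idA idP AP Ph fin; pose J n := adjoin A (z ^+ n * h).
have subJ n m : (n <= m)%N -> subI (J m) (J n).
  move=> /subnK <- _ [i [c [Ai ->]]]; exists i, (c * z ^+ (m - n)).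
  by rewrite exprD !mulrA.
case: (fin (fun K => exists n, K = J n)) => [_ [n ->]|_ _ [n ->] [m ->]|l lP].
- split; first exact: adjoin_ideal.
  split; first exact: adjoin_sub.
  move=> _ [i [c [Ai ->]]]; apply: (idealD idP); first exact: AP.
  by rewrite mulrA; apply: idealMl.
- by case/orP: (leq_total n m) => /subJ; [right|left].
(* Pigeonhole: the first [(size l).+1] terms of the chain fall into [size l] classes. *)
have /fin_all_exists[f fP] : forall n : 'I_(size l).+1, exists i : 'I_(size l),
    eqI (J n) (nth (fun=> False) l i).
  by move=> n; have [|i il E] := lP (J n); [exists n|exists (Ordinal il)].
have [n [m [nm fE]]] : exists n m : 'I_(size l).+1, (n < m)%N /\ f n = f m.
  have /injectivePn[n [m nm fE]] : ~~ injectiveb f.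
    by apply/injectiveP => /leq_card; rewrite !card_ord ltnn.
  by case: (ltngtP n m) => [lt|lt|/val_inj/eqP]; [exists n, m|exists m, n|rewrite (negPf nm)].
have [i [c [Ai E]]] : J m (z ^+ n * h).
  by apply/(fP m); rewrite -fE; apply/(fP n); apply: adjoin_mem.
(* Since [z ^+ n * h = i + c * (z ^+ m * h)] with [n < m], the required product is the element [i]
   of [A]. *)
exists n, (z ^+ (m - n).-1 * c).
suff -> : (1 - z * (z ^+ (m - n).-1 * c)) * (z ^+ n * h) = i by [].
have -> : (1 - z * (z ^+ (m - n).-1 * c)) * (z ^+ n * h) =
  z ^+ n * h - c * (z ^+ (m - n).-1 * z * z ^+ n * h) by ring.
rewrite -exprSr prednK ?subn_gt0 // -exprD subnK; last exact: ltnW.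
by rewrite {1}E mulrA addrK.
Qed.

(* Three vectors of a plane are dependent, here over the residue field of a
   prime [Q] and with all coefficients lifted to the ring. *)
Lemma exists_relation_mod_prime Q (u1 u2 u3 v1 v2 v3 : S) : is_prime Q ->
  exists w1 w2 w3, [/\ ~ (Q w1 /\ Q w2 /\ Q w3),
    Q (w1 * u1 + w2 * u2 + w3 * u3) & Q (w1 * v1 + w2 * v2 + w3 * v3)].
Proof.
move=> prQ; have Q0 : Q 0 by exact: (ideal0 (prime_ideal prQ)).
have nQ1 := prime1 prQ.
(* The vector of 2 by 2 minors is orthogonal to both rows. If all minors vanish modulo [Q], the
   columns are proportional and a relation between the first two, or the first alone, suffices. *)
pose m1 := u2 * v3 - u3 * v2; pose m2 := u3 * v1 - u1 * v3.
pose m3 := u1 * v2 - u2 * v1.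
have [[Qm1 [Qm2 Qm3]]|nQm] := pselect (Q m1 /\ Q m2 /\ Q m3); last first.
  exists m1, m2, m3; split=> //.
    by suff -> : m1 * u1 + m2 * u2 + m3 * u3 = 0 by []; rewrite /m1 /m2 /m3; ring.
  by suff -> : m1 * v1 + m2 * v2 + m3 * v3 = 0 by []; rewrite /m1 /m2 /m3; ring.
have [Qu|nQu] := pselect (Q u1); last first.
  exists (- u2), u1, 0; split; first by case=> _ [].
    by suff -> : - u2 * u1 + u1 * u2 + 0 * u3 = 0 by []; ring.
  by suff -> : - u2 * v1 + u1 * v2 + 0 * v3 = m3 by []; rewrite /m3; ring.
have [Qv|nQv] := pselect (Q v1); last first.
  exists (- v2), v1, 0; split; first by case=> _ [].
    suff -> : - v2 * u1 + v1 * u2 + 0 * u3 = - m3; last by rewrite /m3; ring.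
    exact: (idealN (prime_ideal prQ)).
  by suff -> : - v2 * v1 + v1 * v2 + 0 * v3 = 0 by []; ring.
by exists 1, 0, 0; split; [case|rewrite mul1r !mul0r !addr0..].
Qed.

Lemma prime_chain_to2 Q0 Q1 Q : is_prime Q0 -> is_prime Q1 -> is_prime Q ->
  subI Q0 Q1 -> ~ subI Q1 Q0 -> subI Q1 Q -> ~ subI Q Q1 -> prime_chain_to Q 2.
Proof.
move=> pr0 pr1 pr2 s01 n10 s12 n21.
exists (fun i => match i with 0 => Q0 | 1 => Q1 | _ => Q end).
split; first by case=> [|[]].
by split=> //; case=> [|[|]].
Qed.

End IdealFacts.
#[local] Hint Resolve prime_ideal : core.

(** * Principal ideals, and extension of ideals to [S[X]] *)

Definition multiples (S : comNzRingType) (p x : S) := exists c, x = c * p.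

Definition prime_elt (S : comNzRingType) (p : S) := p != 0 /\ is_prime (multiples p).

Lemma prime_elt_prime (S : comNzRingType) (p : S) : prime_elt p -> is_prime (multiples p).
Proof. by case. Qed.

Definition poly_ideal (S : comNzRingType) (I : S -> Prop) (h : {poly S}) :=
  forall i, I h`_i.

Section PolyIdeal.
Variable S : comNzRingType.

Lemma multiples_ideal (p : S) : is_ideal (multiples p).
Proof.
split; first by exists 0; rewrite mul0r.
split=> [_ _ [c ->] [d ->]|a _ [c ->]]; first by exists (c + d); rewrite mulrDl.
by exists (a * c); rewrite mulrA.
Qed.

Lemma multiples_min (I : S -> Prop) p : is_ideal I -> I p -> subI (multiples p) I.
Proof. by move=> idI Ip _ [c ->]; apply: idealMl. Qed.

Lemma multiples_refl (p : S) : multiples p p.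
Proof. by exists 1; rewrite mul1r. Qed.

Lemma multiples_trans (p q r : S) : multiples p q -> multiples q r -> multiples p r.
Proof. by move=> [c ->] [d ->]; exists (d * c); rewrite mulrA. Qed.

Variable I : S -> Prop.

Lemma poly_ideal_ideal : is_ideal I -> is_ideal (poly_ideal I).
Proof.
move=> idI; split; first by move=> i; rewrite coef0; exact: ideal0.
split=> [f g If Ig i|f g Ig i]; first by rewrite coefD; exact: idealD.
by rewrite coefM; apply: ideal_sum => // j _; exact: idealMl.
Qed.

Lemma poly_idealC c : is_ideal I -> poly_ideal I c%:P <-> I c.
Proof.
move=> idI; split=> [/(_ 0%N)|Ic i]; rewrite coefC //.
by case: eqP => // _; exact: ideal0.
Qed.

Lemma first_coef_notin (f : {poly S}) : ~ poly_ideal I f ->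
  exists2 n, ~ I f`_n & forall i, (i < n)%N -> I f`_i.
Proof.
move=> nIf; have [|n /asboolP nIn minn] := @ex_minnP (fun i => `[< ~ I f`_i >]).
  by have /existsNP[i nIi] := nIf; exists i; apply/asboolP.
exists n => // i; apply: contraTP => nIi; rewrite -leqNgt; apply: minn.
exact/asboolP.
Qed.

(** Gauss's argument: if [n] and [m] are the first indices with coefficients outside [I],
    coefficient [n + m] of the product is the product of these two modulo [I]. *)
Lemma poly_ideal_prime : is_prime I -> is_prime (poly_ideal I).
Proof.
move=> prI; have idI := prime_ideal prI; split; first exact: poly_ideal_ideal.
split=> [|f g Ifg]; first by rewrite -[1]/(1%:P) poly_idealC //; exact: prime1.
apply: contrapT => /not_orP[/first_coef_notin[n nIn minn] /first_coef_notin[m nIm minm]].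
have nI := primeNM prI nIn nIm; apply: nI.
have := Ifg (n + m)%N.
have nlt : (n < (n + m).+1)%N by rewrite ltnS leq_addr.
rewrite coefM (bigD1 (Ordinal nlt)) //= addKn addrC => IS; apply: (ideal_addKr idI _ IS).
apply: ideal_sum => // i /eqP ni.
have [lt|lt|E] := ltngtP i n; last by case: ni; apply: val_inj.
  by apply: idealMr => //; apply: minn.
apply: idealMl => //; apply: minm; rewrite ltn_subLR ?ltn_add2r //.
by rewrite -ltnS.
Qed.

End PolyIdeal.

Lemma multiples_poly (S : comNzRingType) (p : S) (h : {poly S}) :
  multiples p%:P h <-> poly_ideal (multiples p) h.
Proof.
split=> [[c ->] i|]; first by exists c`_i; rewrite coefMC.
elim/poly_ind: h => [|h c IHh] ph; first by exists 0; rewrite mul0r.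
have [|k ->] := IHh.
  by move=> i; have := ph i.+1; rewrite coefD coefMX coefC addr0.
have [d] := ph 0%N; rewrite coefD coefMX coefC add0r => ->.
by exists (k * 'X + d%:P); rewrite polyCM; ring.
Qed.

(** * Prime elements of a unique factorization domain *)

Section PrimeElements.
Variable R : idomainType.
Implicit Types p q x y : R.

Lemma prime_eltX_dvd p n x y : prime_elt p -> ~ multiples p y ->
  multiples (p ^+ n) (x * y) -> multiples (p ^+ n) x.
Proof.
move=> [p0 prp] npy; elim: n x => [|n IHn] x; first by exists x; rewrite mulr1.
case=> c xyE; have [|[d xE]|/npy//] := @primeM _ _ prp x y.
  by exists (c * p ^+ n); rewrite xyE exprSr mulrA.
have [|e dE] := IHn d; last by exists e; rewrite xE dE exprSr mulrA.
exists c; apply: (mulIf p0).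
by rewrite -mulrA [y * p]mulrC mulrA -xE xyE exprSr mulrA.
Qed.

Lemma prime_elt_assoc p q : prime_elt p -> prime_elt q -> multiples p q -> multiples q p.
Proof.
move=> [p0 prp] [q0 prq] [c qE].
have [|[d cE]|//] := @primeM _ _ prq c p; first by rewrite -qE; exact: multiples_refl.
case: (prime1 prp); exists d; apply: (mulfI q0).
by rewrite mulr1 {1}qE cE; ring.
Qed.

Hypothesis ufdR : is_ufd R.

Lemma irreducible_prime p : irreducible_elt p -> prime_elt p.
Proof.
move=> irp; have [p0 [pU _]] := irp; split=> //; split; first exact: multiples_ideal.
split=> [[c E]|x y [z xyE]].
  by case/negP: pU; apply/unitrPr; exists c; rewrite mulrC.
have [ufd1 ufd2] := ufdR.
have [->|x0] := eqVneq x 0; first by left; exists 0; rewrite mul0r.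
have [->|y0] := eqVneq y 0; first by right; exists 0; rewrite mul0r.
have [xU|xU] := boolP (x \is a GRing.unit).
  by right; exists (x^-1 * z); rewrite -mulrA -xyE mulKr.
have [yU|yU] := boolP (y \is a GRing.unit).
  by left; exists (y^-1 * z); rewrite -mulrA -xyE mulrC mulrK.
have z0 : z != 0 by apply: contra_neq (mulf_neq0 x0 y0) => z0; rewrite xyE z0 mul0r.
have [s [irs xE]] := ufd1 _ x0 xU; have [t [irt yE]] := ufd1 _ y0 yU.
have irst a : a \in s ++ t -> irreducible_elt a by rewrite mem_cat => /orP[/irs|/irt].
(* A factorization of [p * z] headed by a multiple of [p], to be compared with that of [x * y]. When
   [z] is a unit it is absorbed into the head. *)
have [r [p' [irr rE [u uE]]]] : exists r p', [/\ forall a, a \in p' :: r -> irreducible_elt a,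
    p * z = \prod_(a <- p' :: r) a & multiples p p'].
  have [zU|zU] := boolP (z \is a GRing.unit).
    exists [::], (p * z); split.
    - move=> a; rewrite inE => /eqP ->; split; first exact: mulf_neq0.
      split=> [|b c E]; first by rewrite unitrM (negPf pU).
      have [|bU|cU] := irp.2.2 b (c * z^-1).
      + by rewrite mulrA -E mulrK.
      + by left.
      + by right; rewrite -[c](divrK zU) unitrM cU.
    - by rewrite big_seq1.
    - by exists z; rewrite mulrC.
  have [r [irr zE]] := ufd1 _ z0 zU.
  exists r, p; split; [|by rewrite big_cons zE|exact: multiples_refl].
  by move=> a; rewrite inE => /orP[/eqP ->|/irr].
have [|t' [pt [st ass]]] := ufd2 _ _ irr irst.
  by rewrite -rE big_cat /= -xE -yE xyE mulrC.
have [v [vU p'E]] := ass 0%N isT.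
have t'0 : nth 0 t' 0 \in s ++ t.
  by rewrite (perm_mem pt) mem_nth // -st.
have pt' : multiples p (nth 0 t' 0).
  by exists (v^-1 * u); rewrite -mulrA -uE /= -[p']/(nth 0 (p' :: r) 0) p'E mulKr.
have dvd_prod (l : seq R) a : a \in l -> multiples a (\prod_(b <- l) b).
  elim: l => // b l IHl; rewrite inE big_cons => /orP[/eqP ->|/IHl[c ->]].
    by rewrite mulrC; exists (\prod_(b <- l) b).
  by exists (b * c); rewrite mulrA.
move: t'0; rewrite mem_cat => /orP[/dvd_prod|/dvd_prod] dv; [left|right].
  by rewrite xE; apply: multiples_trans dv.
by rewrite yE; apply: multiples_trans dv.
Qed.

Lemma exists_prime_elt (Q : R -> Prop) x : is_prime Q -> Q x -> x != 0 ->
  exists p, [/\ prime_elt p, Q p & multiples p x].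
Proof.
move=> prQ Qx x0.
have xU : x \isn't a GRing.unit.
  apply/negP => xU; apply: (prime1 prQ); rewrite -(mulVr xU).
  exact: (idealMl (prime_ideal prQ)) Qx.
have [s [irs xE]] := ufdR.1 _ x0 xU.
rewrite xE in Qx *; have [a sa Qa] := prime_prod prQ Qx.
exists a; split=> //; first exact/irreducible_prime/irs.
by rewrite (big_rem _ sa) /= mulrC; eexists.
Qed.

(** Induction on a factorization into irreducibles: a factor divisible by [p] is a unit times [p]
    and raises the exponent by one. *)
Lemma prime_elt_valuation p x : prime_elt p -> x != 0 ->
  exists e r, ~ multiples p r /\ x = r * p ^+ e.
Proof.
move=> [p0 prp] x0.
have nunit u : u \is a GRing.unit -> ~ multiples p u.
  move=> uU [c E]; apply: (prime1 prp); exists (u^-1 * c).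
  by rewrite -mulrA -E mulVr.
have [xU|xU] := boolP (x \is a GRing.unit).
  by exists 0%N, x; rewrite mulr1; split=> //; exact: nunit.
have [s [irs ->]] := ufdR.1 _ x0 xU.
elim: s irs => [|a s IHs] irs.
  by exists 0%N, 1; rewrite big_nil mulr1; split=> //; exact: prime1.
have [|e [r [nr sE]]] := IHs; first by move=> b bs; apply: irs; rewrite inE bs orbT.
rewrite big_cons sE.
have [[c aE]|npa] := pselect (multiples p a); last first.
  by exists e, (a * r); rewrite mulrA; split=> //; exact: primeNM.
have [_ [_ ira]] := irs a (mem_head _ _).
have cU : c \is a GRing.unit.
  by have [//|/nunit[]] := ira _ _ aE; exact: multiples_refl.
exists e.+1, (c * r); split; first by apply: primeNM => //; exact: nunit.
by rewrite aE exprS; ring.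
Qed.

End PrimeElements.

(** * Localization at a prime *)

(** The contraction to [S] of the ideal that [A] generates in the local ring at [N]; local
    membership is thus expressed without fractions. *)
Definition loc (S : comNzRingType) (N A : S -> Prop) (h : S) :=
  exists2 s, ~ N s & A (s * h).

Section Localization.
Variables (S : comNzRingType) (N A : S -> Prop).
Hypotheses (prN : is_prime N) (idA : is_ideal A).

Lemma loc_ideal : is_ideal (loc N A).
Proof.
split; first by exists 1; [exact: prime1|rewrite mulr0; exact: ideal0].
split=> [x y [s ns As] [t nt At]|a x [s ns As]]; last first.
  by exists s; rewrite // mulrCA; exact: idealMl.
exists (s * t); first exact: primeNM.
rewrite mulrDr; apply: idealD => //; last by rewrite -mulrA; exact: idealMl.
by rewrite [s * t]mulrC -mulrA; exact: idealMl.
Qed.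

Lemma loc_sub : subI A (loc N A).
Proof. by move=> x Ax; exists 1; [exact: prime1|rewrite mul1r]. Qed.

Lemma loc_cancel s x : ~ N s -> loc N A (s * x) -> loc N A x.
Proof. by move=> ns [t nt Ax]; exists (t * s); [exact: primeNM|rewrite -mulrA]. Qed.

Lemma loc_min Q : is_prime Q -> subI A Q -> subI Q N -> subI (loc N A) Q.
Proof. by move=> prQ AQ QN x [s ns /AQ /(primeM prQ)[/QN|]]. Qed.

Variables z1 z2 z3 : S.
Hypothesis no_socle : forall h, A (z1 * h) -> A (z2 * h) -> A (z3 * h) -> A h.

Lemma loc_no_socle h :
  loc N A (z1 * h) -> loc N A (z2 * h) -> loc N A (z3 * h) -> loc N A h.
Proof.
move=> [s1 n1 A1] [s2 n2 A2] [s3 n3 A3].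
exists (s1 * s2 * s3); first by do 2?apply: primeNM => //.
apply: no_socle.
- have -> : z1 * (s1 * s2 * s3 * h) = (s2 * s3) * (s1 * (z1 * h)) by ring.
  exact: idealMl.
- have -> : z2 * (s1 * s2 * s3 * h) = (s1 * s3) * (s2 * (z2 * h)) by ring.
  exact: idealMl.
- have -> : z3 * (s1 * s2 * s3 * h) = (s1 * s2) * (s3 * (z3 * h)) by ring.
  exact: idealMl.
Qed.

(** Induction on the sum of the exponents: each of [z1 * h], [z2 * h], [z3 * h] satisfies the
    hypotheses with a smaller sum, and the absence of a socle brings the conclusion back to [h]. *)
Lemma loc_of_powers h n1 n2 n3 : loc N A (z1 ^+ n1 * h) ->
  loc N A (z2 ^+ n2 * h) -> loc N A (z3 ^+ n3 * h) -> loc N A h.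
Proof.
have idL := loc_ideal.
have up z w k g : loc N A (z ^+ k * g) -> loc N A (z ^+ k * (w * g)).
  by rewrite mulrCA; exact: idealMl.
have [m] := ubnP (n1 + n2 + n3); elim: m => // m IHm in n1 n2 n3 h *.
rewrite ltnS => le.
case: n1 le => [|n1] le; first by rewrite mul1r.
case: n2 le => [|n2] le; first by rewrite mul1r.
case: n3 le => [|n3] le; first by rewrite mul1r.
move=> L1 L2 L3; apply: loc_no_socle.
- apply: (IHm n1 n2.+1 n3.+1); [|by rewrite mulrA -exprSr|exact: up..].
  by move: le; rewrite !addSn.
- apply: (IHm n1.+1 n2 n3.+1); [|exact: up|by rewrite mulrA -exprSr|exact: up].
  by move: le; rewrite !addSn !addnS.
- apply: (IHm n1.+1 n2.+1 n3); [|exact: up|exact: up|by rewrite mulrA -exprSr].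
  by move: le; rewrite !addSn !addnS.
Qed.

End Localization.

(** * Koszul relations and the socle *)

Lemma poly_cons_coef0 (S : nzRingType) (p : {poly S}) :
  exists q, p = q * 'X + (p`_0)%:P.
Proof.
elim/poly_ind: p => [|q c _]; first by exists 0; rewrite mul0r coef0 polyC0 addr0.
by exists q; rewrite coefD coefMX coefC add0r.
Qed.

(* The Koszul complexes of [f, g] and of [a, b, 'X] are exact in positive degrees,
   so [Tor_3] of the two quotients vanishes; it is the socle of the first one
   with respect to [a, b, 'X]. *)
Lemma koszul_no_socle (R : idomainType) (a b : R) (f g h : {poly R}) :
  a != 0 -> (forall u, multiples a (b * u) -> multiples a u) ->
  (forall u v, f * u = g * v -> exists c, u = g * c /\ v = f * c) ->
  (exists u v, a%:P * h = u * f + v * g) -> (exists u v, b%:P * h = u * f + v * g) ->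
  (exists u v, 'X * h = u * f + v * g) -> exists u v, h = u * f + v * g.
Proof.
move=> a0 cop_ab cop_fg [x1 [y1 E1]] [x2 [y2 E2]] [x3 [y3 E3]].
have aP0 : a%:P != 0 :> {poly R} by rewrite polyC_eq0.
have cop_abP u : multiples a%:P (b%:P * u) -> multiples a%:P u.
  move=> /multiples_poly mu; apply/multiples_poly => i; apply: cop_ab.
  by have := mu i; rewrite coefCM.
(* Eliminating [h] between two of the three equations gives a syzygy of [(f, g)], which is a
   multiple of the Koszul one. *)
have [|c12 [F12 G12]] := cop_fg (b%:P * x1 - a%:P * x2) (a%:P * y2 - b%:P * y1).
  apply/eqP; rewrite -subr_eq0; apply/eqP.
  transitivity (b%:P * (x1 * f + y1 * g) - a%:P * (x2 * f + y2 * g)); first by ring.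
  by rewrite -E1 -E2; ring.
have [|c13 [F13 G13]] := cop_fg ('X * x1 - a%:P * x3) (a%:P * y3 - 'X * y1).
  apply/eqP; rewrite -subr_eq0; apply/eqP.
  transitivity ('X * (x1 * f + y1 * g) - a%:P * (x3 * f + y3 * g)); first by ring.
  by rewrite -E1 -E3; ring.
have [|c23 [F23 G23]] := cop_fg ('X * x2 - b%:P * x3) (b%:P * y3 - 'X * y2).
  apply/eqP; rewrite -subr_eq0; apply/eqP.
  transitivity ('X * (x2 * f + y2 * g) - b%:P * (x3 * f + y3 * g)); first by ring.
  by rewrite -E2 -E3; ring.
(* The multipliers form a syzygy of [(a, b, 'X)] after multiplication by [f] or by [g]. One of these
   is nonzero, since otherwise [cop_fg] would fail at [1, 1]. *)
have K : 'X * c12 - b%:P * c13 + a%:P * c23 = 0.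
  have gK : g * ('X * c12 - b%:P * c13 + a%:P * c23) = 0.
    transitivity ('X * (g * c12) - b%:P * (g * c13) + a%:P * (g * c23)); first by ring.
    by rewrite -F12 -F13 -F23; ring.
  have fK : f * ('X * c12 - b%:P * c13 + a%:P * c23) = 0.
    transitivity ('X * (f * c12) - b%:P * (f * c13) + a%:P * (f * c23)); first by ring.
    by rewrite -G12 -G13 -G23; ring.
  have [g0|g0] := eqVneq g 0; last by move/eqP: gK; rewrite mulf_eq0 (negPf g0) => /eqP.
  have [f0|f0] := eqVneq f 0; last by move/eqP: fK; rewrite mulf_eq0 (negPf f0) => /eqP.
  have [|c [/eqP]] := cop_fg 1 1; first by rewrite f0 g0.
  by rewrite g0 mul0r oner_eq0.
(* Solving [K]: its constant term makes the constant terms of [c13] and [c23] equal to [r * a] and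
   [r * b]; what remains is divisible by ['X]. *)
have [e1 c13E] := poly_cons_coef0 c13; have [e2 c23E] := poly_cons_coef0 c23.
have K0 : b * c13`_0 = a * c23`_0.
  have := congr1 (fun p : {poly R} => p`_0) K.
  rewrite !coefD coefN coefXM !coefCM coef0 /= add0r => /eqP.
  by rewrite addrC subr_eq0 => /eqP.
have [|r rE] := cop_ab c13`_0; first by rewrite K0 mulrC; exists c23`_0.
have r'E : c23`_0 = r * b.
  by apply: (mulfI a0); rewrite -K0 rE; ring.
have c12E : c12 = b%:P * e1 - a%:P * e2.
  apply: (@mulfI _ 'X); first by rewrite polyX_eq0.
  have := K; rewrite c13E c23E rE r'E !polyCM => /eqP.
  by rewrite -subr_eq0 => /eqP KE; apply/eqP; rewrite -subr_eq0; apply/eqP; rewrite -[RHS]KE; ring.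
(* Replacing [x1], [y1] by [x1 - g * e1], [y1 + f * e1] keeps [x1 * f + y1 * g] and makes both
   coefficients divisible by [a]. *)
have [|w wE] := cop_abP (x1 - g * e1).
  exists (x2 - g * e2).
  apply/eqP; rewrite -subr_eq0; apply/eqP.
  transitivity ((b%:P * x1 - a%:P * x2) - g * (b%:P * e1 - a%:P * e2)); first by ring.
  by rewrite F12 c12E; ring.
have [|w' w'E] := cop_abP (y1 + f * e1).
  exists (y2 + f * e2).
  apply/eqP; rewrite -subr_eq0; apply/eqP.
  transitivity (f * (b%:P * e1 - a%:P * e2) - (a%:P * y2 - b%:P * y1)); first by ring.
  by rewrite G12 c12E; ring.
exists w, w'; apply: (mulfI aP0); rewrite E1.
transitivity ((x1 - g * e1) * f + (y1 + f * e1) * g); first by ring.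
by rewrite wE w'E; ring.
Qed.

(** * Ideals with two generators, and what radical finiteness gives for them *)

Definition span2 (S : comNzRingType) (f g h : S) := exists u v, h = u * f + v * g.

Section Span2.
Variable S : comNzRingType.
Implicit Types f g : S.

Lemma span2_ideal f g : is_ideal (span2 f g).
Proof.
split; first by exists 0, 0; rewrite !mul0r addr0.
split=> [_ _ [u [v ->]] [u' [v' ->]]|a _ [u [v ->]]].
  by exists (u + u'), (v + v'); ring.
by exists (a * u), (a * v); ring.
Qed.

Lemma span2l f g : span2 f g f. Proof. by exists 1, 0; ring. Qed.
Lemma span2r f g : span2 f g g. Proof. by exists 0, 1; ring. Qed.

Lemma span2_min (I : S -> Prop) f g : is_ideal I -> I f -> I g -> subI (span2 f g) I.
Proof. by move=> idI If Ig _ [u [v ->]]; apply: idealD => //; apply: idealMl. Qed.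

Lemma gen_span2 (th : 'I_2 -> S) : eqI (gen th) (span2 (th ord0) (th (lift ord0 ord0))).
Proof. by move=> x; split=> [/gen2E|?]; last exact/gen2E. Qed.

(** Radical perfection takes the place of Krull's height theorem: two generators up to radical bound
    the height by two. *)
Lemma ht_ge_two_gen (P : S -> Prop) f g : radically_perfect P -> is_prime P -> P f -> P g ->
  (forall h, P h -> exists n, span2 f g (h ^+ n)) -> ~ ht_ge P 3.
Proof.
move=> [ht_ara _] prP Pf Pg fgP /ht_ara/(_ 2%N isT); apply.
exists (fun i => if i == ord0 then f else g) => x; split=> -[n].
  move=> /fgP[m Exm]; exists (n * m)%N; rewrite exprM.
  exact/gen_span2.
move=> /gen_span2 Exn; exists n; apply: (span2_min _ _ _ Exn) => //.
exact: prime_ideal.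
Qed.

(** The chain condition is used on the chains [A + (z ^+ n * h)] alone. At a prime not containing
    [1 - z * w], the last clause says that a power of [z] carries [h] into [(f, g)]. *)
Lemma radically_finite_two_gen (P : S -> Prop) :
  radically_finite S -> is_prime P -> ht_is P 2 -> exists f g, [/\ P f, P g,
    forall h, P h -> exists n, span2 f g (h ^+ n) &
    forall h z, P h -> exists n w, span2 f g ((1 - z * w) * (z ^+ n * h))].
Proof.
move=> rfS prP htP; have [_ /(_ _ htP)] := rfS _ prP.
move=> [A [[idA [[th thA] radA]] [_ fin]]].
have AE x : A x <-> span2 (th ord0) (th (lift ord0 ord0)) x.
  by split=> [/thA/gen_span2//|?]; apply/thA/gen_span2.
have AP : subI A P by move=> x Ax; apply/radA; exists 1%N.
exists (th ord0), (th (lift ord0 ord0)); split.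
- exact/AP/AE/span2l.
- exact/AP/AE/span2r.
- by move=> h /radA[n /AE]; exists n.
- move=> h z Ph; have [|n [w /AE]] := finite_chain_power z idA _ AP Ph fin.
    exact: prime_ideal.
  by exists n, w.
Qed.

End Span2.

(** * Descent of two local generators from [M[X]] to [M] *)

Section LocalGenerators.
Variables (R : comNzRingType) (M : R -> Prop).
Hypothesis prM : is_prime M.
Let idM := prime_ideal prM.
Let Q := poly_ideal M.
Let prQ : is_prime Q := poly_ideal_prime prM.
Let idQ := prime_ideal prQ.

Definition local_gens n (c : 'I_n -> R) :=
  (forall i, M (c i)) /\ forall m, M m -> loc M (gen c) m.

Lemma local_gens_poly n (c : 'I_n -> R) f : local_gens c -> Q f ->
  exists t phi, ~ M t /\ t%:P * f = \sum_i phi i * (c i)%:P.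
Proof.
move=> [_ lgc]; elim/poly_ind: f => [_|f d IHf Qf].
  exists 1, (fun=> 0); split; first exact: prime1.
  by rewrite mulr0 big1 // => i _; rewrite mul0r.
have [|t [phi [nt tf]]] := IHf.
  by move=> i; have := Qf i.+1; rewrite coefD coefMX coefC addr0.
have [|s ns [e se]] := lgc d.
  by have := Qf 0%N; rewrite coefD coefMX coefC add0r.
exists (t * s), (fun i => s%:P * 'X * phi i + t%:P * (e i)%:P); split; first exact: primeNM.
transitivity (s%:P * 'X * (t%:P * f) + t%:P * (s * d)%:P).
  by rewrite !polyCM; ring.
rewrite tf se rmorph_sum !mulr_sumr -big_split; apply: eq_bigr => i _.
by rewrite /= polyCM; ring.
Qed.

Variables f g : {poly R}.
Hypotheses (Qf : Q f) (Qg : Q g).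
Hypothesis Mfg : forall m, M m -> loc Q (span2 f g) m%:P.

(** If [s * m = u * f + v * g] with [s] outside [M[X]], a coefficient of [s] outside [M] carries [m]
    into the ideal of the coefficients of [f] and [g]. The two extra indices give zeros and
    guarantee the two generators at which the descent stops. *)
Lemma local_gens_coef :
  local_gens (fun i : 'I_(size f + size g).+2 => (f ++ g)`_i).
Proof.
set c := fun i : 'I_ _ => _.
have Mnth i : M (f ++ g)`_i.
  by rewrite nth_cat; case: ifP => _; [exact: Qf|exact: Qg].
split=> [i|m /Mfg[s /existsNP[k nMk] [u [v E]]]]; first exact: Mnth.
have cn i : gen c (f ++ g)`_i.
  have [lt|ge] := ltnP i (size f + size g).+2; first exact: (gen_mem c (Ordinal lt)).
  rewrite nth_default; first exact: (ideal0 (gen_ideal c)).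
  by rewrite size_cat; do 2!apply: ltnW.
have cf i : gen c f`_i.
  have := cn i; rewrite nth_cat; case: ltnP => // ge _.
  by rewrite nth_default //; exact: (ideal0 (gen_ideal c)).
have cg i : gen c g`_i.
  by have := cn (size f + i)%N; rewrite nth_cat ltnNge leq_addr /= addKn.
exists s`_k => //; have := congr1 (fun p : {poly R} => p`_k) E.
rewrite /= coefMC coefD !coefM => ->.
apply: (idealD (gen_ideal c)); apply: (ideal_sum (gen_ideal c)) => i _;
  exact: (idealMl (gen_ideal c)).
Qed.

(** Locally at [M[X]] three of the generators are combinations of [f] and [g], so a combination of
    them, nontrivial modulo [M[X]], has the form [U * f + V * g] with [U] and [V] in [M[X]]. As in
    Nakayama's lemma, one generator is then redundant. *)
Lemma local_gens_drop n (c : 'I_n.+3 -> R) : local_gens c ->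
  exists j, local_gens (fun i => c (lift j i)).
Proof.
move=> lgc; have [Mc lgM] := lgc.
have /fin_all_exists[s] : forall i, exists s, ~ Q s /\ span2 f g (s * (c i)%:P).
  by move=> i; have [s ns E] := Mfg (Mc i); exists s.
move=> /all_and2[ns /fin_all_exists[u /fin_all_exists[v E]]].
pose i0 : 'I_n.+3 := ord0; pose i1 : 'I_n.+3 := lift ord0 ord0.
pose i2 : 'I_n.+3 := lift ord0 (lift ord0 ord0).
have [w1 [w2 [w3 [nw Qu Qv]]]] :=
  exists_relation_mod_prime (u i0) (u i1) (u i2) (v i0) (v i1) (v i2) prQ.
pose w (i : 'I_n.+3) := [:: w1; w2; w3]`_i.
have sumw (F : 'I_n.+3 -> {poly R}) :
    \sum_i w i * F i = w1 * F i0 + w2 * F i1 + w3 * F i2.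
  rewrite !big_ord_recl big1 ?addr0 ?addrA // => i _.
  by rewrite /w /= nth_nil mul0r.
have [j nwj] : exists j, ~ Q (w j).
  apply: contrapT => /forallNP nex; apply: nw.
  by split; [|split]; apply: contrapT; [exact: (nex i0)|exact: (nex i1)|exact: (nex i2)].
have [U [UE QU]] : exists U, U = \sum_i w i * u i /\ Q U by rewrite -sumw in Qu; eexists.
have [V [VE QV]] : exists V, V = \sum_i w i * v i /\ Q V by rewrite -sumw in Qv; eexists.
have [t [phi [nt tf]]] := local_gens_poly lgc Qf.
have [t' [psi [nt' tg]]] := local_gens_poly lgc Qg.
(* [mu] writes [t * t' * (U * f + V * g)] in the [c i] with coefficients in [M[X]]; so [nu] is a
   relation among the [c i] whose entry at [j] lies outside [M[X]]. A coefficient of that entry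
   outside [M] then solves for [c j]. *)
pose mu i := t'%:P * U * phi i + t%:P * V * psi i.
pose nu i := t%:P * t'%:P * (w i * s i) - mu i.
have nu0 : \sum_i nu i * (c i)%:P = 0.
  transitivity (t%:P * t'%:P * (\sum_i w i * (s i * (c i)%:P)) -
      (t'%:P * U * (t%:P * f) + t%:P * V * (t'%:P * g))).
    rewrite tf tg !mulr_sumr -big_split -sumrB; apply: eq_bigr => i _ /=.
    by rewrite /nu /mu; ring.
  under eq_bigr => i _ do rewrite E mulrDr !mulrA.
  by rewrite big_split /= -!mulr_suml -UE -VE; ring.
have nQnu : ~ Q (nu j).
  move=> Qnu; have : Q (t%:P * t'%:P * (w j * s j)).
    rewrite -[X in Q X](subrK (mu j)); apply: (idealD idQ) => //.
    by apply: (idealD idQ); apply: (idealMr idQ); apply: (idealMl idQ).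
  have nQC d : ~ M d -> ~ Q d%:P by move=> nd /(poly_idealC _ idM).
  by do 2!apply: (primeNM prQ); auto.
have /existsNP[k nMk] := nQnu.
have cj : loc M (gen (fun i => c (lift j i))) (c j).
  exists (nu j)`_k => //.
  have := congr1 (fun p : {poly R} => p`_k) nu0.
  rewrite /= coef_sum coef0 (bigD1_ord j) //= coefMC => /eqP.
  rewrite addr_eq0 => /eqP ->; apply: idealN; first exact: gen_ideal.
  apply: ideal_sum => [|i _]; first exact: gen_ideal.
  rewrite coefMC; apply: idealMl; first exact: gen_ideal.
  exact: (gen_mem (fun i => c (lift j i))).
exists j; split=> [i|m /lgM[r nr cm]]; first exact: Mc.
have idl := loc_ideal prM (gen_ideal (fun i => c (lift j i))).
apply: (loc_cancel prM nr); apply: (gen_min idl _ cm) => i.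
case: (unliftP j i) => [i' ->|-> //]; apply: loc_sub => //.
exact: (gen_mem (fun i => c (lift j i))).
Qed.

Lemma two_local_gens : exists a b, [/\ M a, M b & forall m, M m -> loc M (span2 a b) m].
Proof.
have := local_gens_coef; set c := fun i : 'I_ _ => _; move: c.
elim: (size f + size g)%N => [|n IHn] c lgc; last by have [j /IHn] := local_gens_drop lgc.
exists (c ord0), (c (lift ord0 ord0)); case: lgc => Mc lgc; split=> // m /lgc[s ns /gen_span2].
by exists s.
Qed.

End LocalGenerators.

(** * The cusp [b ^+ 3 - a ^+ 4] and its prime factor in [M] *)

Section CuspFactor.
Variables (R : idomainType) (M : R -> Prop).
Hypotheses (ufdR : is_ufd R) (prM : is_prime M).
Let idM := prime_ideal prM.

(** [p0] and [y] witness that [M] has height above one: if [p] generated [M] locally, [p0] would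
    divide [p] and therefore [y]. *)
Lemma not_local_principal p0 y p : prime_elt p0 -> M p0 -> M y -> ~ multiples p0 y ->
  prime_elt p -> M p -> ~ (forall m, M m -> loc M (multiples p) m).
Proof.
move=> [p00 prp0] Mp0 My npy prp Mp locp.
have p0M : subI (multiples p0) M by exact: multiples_min.
have [t nt [c E]] := locp _ Mp0.
have p0p : multiples p0 p.
  have [|[d cE]|//] := @primeM _ _ prp0 c p; first by rewrite -E; exists t.
  case: nt; suff -> : t = d * p by exact: idealMl.
  by apply: (mulIf p00); rewrite E cE; ring.
have [s ns [e E']] := locp _ My; apply: npy.
apply: (@primeMl _ _ prp0 s); first by move/p0M.
by rewrite E'; apply: idealMl => //; exact: multiples_ideal.
Qed.

(** Replacing each generator by a prime factor in [M] only enlarges the ideal inside [M]; a zero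
    generator is replaced by [p0]. If one prime divided the other, [M] would be locally
    principal. *)
Lemma two_prime_local_gens p0 y a b : prime_elt p0 -> M p0 -> M y -> ~ multiples p0 y ->
  M a -> M b -> (forall m, M m -> loc M (span2 a b) m) ->
  exists p q, [/\ prime_elt p, prime_elt q, M p, M q & ~ multiples p q /\
    forall m, M m -> loc M (span2 p q) m].
Proof.
move=> prp0 Mp0 My npy Ma Mb Mab.
have div x : M x -> exists p, [/\ prime_elt p, M p & multiples p x].
  move=> Mx; have [->|x0] := eqVneq x 0; last exact: exists_prime_elt.
  by exists p0; split=> //; exists 0; rewrite mul0r.
have [p [prp Mp pa]] := div _ Ma; have [q [prq Mq qb]] := div _ Mb.
have idpq := span2_ideal p q.
have Mpq m : M m -> loc M (span2 p q) m.
  move=> /Mab[s ns abm]; exists s => //; apply: span2_min abm => //.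
    by apply: multiples_min pa => //; exact: span2l.
  by apply: multiples_min qb => //; exact: span2r.
exists p, q; split=> //; split=> // qp.
apply: (@not_local_principal p0 y p) => // m /Mpq[s ns pqm]; exists s => //.
apply: span2_min pqm => //; first exact: multiples_ideal.
exact: multiples_refl.
Qed.

Variables a b : R.
Hypotheses (pra : prime_elt a) (prb : prime_elt b) (Ma : M a) (Mb : M b).
Hypotheses (nab : ~ multiples a b) (Mab : forall m, M m -> loc M (span2 a b) m).

Lemma multiples_coprime u : multiples a (b * u) -> multiples a u.
Proof. by move=> bu; exact: (primeMl (prime_elt_prime pra) nab bu). Qed.

Lemma multiples_coprime' u : multiples b (a * u) -> multiples b u.
Proof.
move=> au; apply: (primeMl (prime_elt_prime prb) _ au).
by move=> /(prime_elt_assoc prb pra).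
Qed.

Definition quadratic (x : R) := exists c1 c2 c3, x = c1 * a ^+ 2 + c2 * (a * b) + c3 * b ^+ 2.

Lemma quadratic_ideal : is_ideal quadratic.
Proof.
split; first by exists 0, 0, 0; rewrite !mul0r !addr0.
split=> [_ _ [c1 [c2 [c3 ->]]] [d1 [d2 [d3 ->]]]|e _ [c1 [c2 [c3 ->]]]].
  by exists (c1 + d1), (c2 + d2), (c3 + d3); ring.
by exists (e * c1), (e * c2), (e * c3); ring.
Qed.

(** As [a] and [b] generate [M] locally, this is the second symbolic power of [M]. *)
Definition local_square := loc M quadratic.

Lemma local_square_ideal : is_ideal local_square.
Proof. exact: loc_ideal quadratic_ideal. Qed.

Lemma local_square_sub x : local_square x -> M x.
Proof.
apply: loc_min => // _ [c1 [c2 [c3 ->]]].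
rewrite !expr2.
by apply: idealD => //; [apply: idealD => //|]; apply: idealMl => //; apply: idealMl.
Qed.

Lemma local_squareM x y : M x -> M y -> local_square (x * y).
Proof.
move=> /Mab[s ns [u [v sE]]] /Mab[t nt [u' [v' tE]]].
exists (s * t); first exact: primeNM.
exists (u * u'), (u * v' + v * u'), (v * v').
transitivity ((s * x) * (t * y)); first by ring.
by rewrite sE tE; ring.
Qed.

(** The classes of [a] and [b] are a basis of [M] modulo its square, locally: [b] divides
    [a * (t * x - c1 * a)], hence [t * x - c1 * a], and symmetrically for [y]. *)
Lemma local_square_independent x y : local_square (x * a + y * b) -> M x /\ M y.
Proof.
move=> [t nt [c1 [c2 [c3 E]]]]; split; apply: (primeMl prM nt).
  have [|c cE] := @multiples_coprime' (t * x - c1 * a).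
    exists (c2 * a + c3 * b - t * y).
    apply/eqP; rewrite -subr_eq0; apply/eqP.
    by rewrite -[RHS](subrr (t * (x * a + y * b))) {2}E; ring.
  rewrite -[t * x](subrK (c1 * a)) cE.
  by apply: idealD => //; apply: idealMl.
have [|c cE] := @multiples_coprime (t * y - c3 * b).
  exists (c1 * a + c2 * b - t * x).
  apply/eqP; rewrite -subr_eq0; apply/eqP.
  by rewrite -[RHS](subrr (t * (x * a + y * b))) {2}E; ring.
rewrite -[t * y](subrK (c3 * b)) cE.
by apply: idealD => //; apply: idealMl.
Qed.

Let cusp := b ^+ 3 - a ^+ 4.

Lemma cusp_nmultiple : ~ multiples a cusp /\ ~ multiples b cusp.
Proof.
split=> -[c E].
  apply/nab/(primeX (prime_elt_prime pra) (n := 3)); exists (c + a ^+ 3).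
  by rewrite -[LHS](subrK (a ^+ 4)) -/cusp E; ring.
apply/nab/(prime_elt_assoc prb pra)/(primeX (prime_elt_prime prb) (n := 4)); exists (b ^+ 2 - c).
by rewrite mulrBl -E /cusp; ring.
Qed.

(* A smooth branch [x a + y b = 0] meets the cusp in a nonzero power of [a] or of [b]. *)
Lemma prime_factor_cusp rho : prime_elt rho -> M rho -> multiples rho cusp ->
  local_square rho.
Proof.
move=> prr Mr rc; have [rho0 prrho] := prr.
have idr := multiples_ideal rho; have rM : subI (multiples rho) M by exact: multiples_min.
have nra : ~ multiples rho a.
  by move=> /(prime_elt_assoc prr pra)/multiples_trans/(_ rc)/cusp_nmultiple.1.
have nrb : ~ multiples rho b.
  by move=> /(prime_elt_assoc prr prb)/multiples_trans/(_ rc)/cusp_nmultiple.2.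
have [t nt [x [y E]]] := Mab Mr.
(* Modulo [rho], [x * a = - y * b] and [a ^+ 4 = b ^+ 3]. Fourth powers give [x ^+ 4 = y ^+ 4 * b]
   after cancelling [b ^+ 3], so [x] lies in [M]. *)
have [Mx|nx] := pselect (M x); last first.
  case: nx; apply: (primeX prM (n := 4)).
  suff rd : multiples rho (x ^+ 4 - y ^+ 4 * b).
    rewrite -[_ ^+ _](subrK (y ^+ 4 * b)).
    by apply: (idealD idM); [exact: rM|exact: (idealMl idM)].
  apply: (primeMl prrho (x := b ^+ 3)); first exact: prime_NX.
  have -> : b ^+ 3 * (x ^+ 4 - y ^+ 4 * b) =
      x ^+ 4 * cusp + ((x * a) ^+ 4 - (y * b) ^+ 4) by rewrite /cusp; ring.
  apply: idealD => //; first exact: idealMl.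
  exists (t * (x * a - y * b) * ((x * a) ^+ 2 + (y * b) ^+ 2)).
  transitivity ((t * rho) * (x * a - y * b) * ((x * a) ^+ 2 + (y * b) ^+ 2)); last by ring.
  by rewrite E; ring.
have [My|ny] := pselect (M y).
  apply: (loc_cancel prM nt); rewrite E.
  by apply: idealD; [exact: local_square_ideal|exact: local_squareM..].
(* Expanding [x] turns the branch into [x1 * a ^+ 2 + Y * b]. Modulo [rho], cubes give
   [x1 ^+ 3 * a ^+ 2 + Y ^+ 3 = 0] after cancelling [a ^+ 4], which forces [Y] into [M]. *)
have [s ns [x1 [x2 E']]] := Mab Mx.
pose Y := x2 * a + s * y.
have nY : ~ M Y.
  move=> /(ideal_addKr idM (idealMl idM x2 Ma)); exact: primeNM.
case: nY; apply: (primeX prM (n := 3)).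
suff rd : multiples rho (x1 ^+ 3 * a ^+ 2 + Y ^+ 3).
  by apply: (ideal_addKr idM _ (rM _ rd)); apply: (idealMl idM); exact: (idealMl idM).
apply: (primeMl prrho (x := a ^+ 4)); first exact: prime_NX.
have EY : s * t * rho = x1 * a ^+ 2 + Y * b.
  rewrite -mulrA E /Y.
  transitivity ((s * x) * a + s * y * b); first by ring.
  by rewrite E'; ring.
have -> : a ^+ 4 * (x1 ^+ 3 * a ^+ 2 + Y ^+ 3) =
    ((x1 * a ^+ 2) ^+ 3 + (Y * b) ^+ 3) - Y ^+ 3 * cusp by rewrite /cusp; ring.
apply: idealB => //; last exact: idealMl.
exists (s * t * ((x1 * a ^+ 2) ^+ 2 - (x1 * a ^+ 2) * (Y * b) + (Y * b) ^+ 2)).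
transitivity ((s * t * rho) * ((x1 * a ^+ 2) ^+ 2 - (x1 * a ^+ 2) * (Y * b) + (Y * b) ^+ 2));
  last by ring.
by rewrite EY; ring.
Qed.

(** Two prime factors in [M] would each have order at least two at [M], so the cusp would have order
    at least four, against the term [b ^+ 3]. *)
Lemma cusp_factorization :
  exists p c, [/\ prime_elt p, M p, ~ M c, cusp = c * p & ~ multiples p a].
Proof.
have cusp0 : cusp != 0.
  apply/eqP => cusp0; apply: cusp_nmultiple.1; rewrite cusp0.
  by exists 0; rewrite mul0r.
have Mcusp : M cusp.
  by apply: idealB => //; rewrite exprS; apply: idealMr.
have [p [prp Mp pcusp]] := exists_prime_elt ufdR prM Mcusp cusp0.
have [c cE] := pcusp.
exists p, c; split=> // [Mc|pa]; last first.
  by apply: cusp_nmultiple.1; apply: multiples_trans pcusp; exact: prime_elt_assoc.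
have c0 : c != 0 by apply: contra_neq cusp0 => c0; rewrite cE c0 mul0r.
have [q [prq Mq [d dE]]] := exists_prime_elt ufdR prM Mc c0.
have [t nt [c1 [c2 [c3 tE]]]] := prime_factor_cusp prp Mp pcusp.
have [|s ns [d1 [d2 [d3 sE]]]] := prime_factor_cusp prq Mq.
  by exists (d * p); rewrite cE dE; ring.
apply: (primeNM prM nt ns).
(* Modulo [a], equating the cusp with the product of the two quadratic forms leaves [b ^+ 3] times
   [t * s - d * c3 * d3 * b]. *)
have [|e eE] := @multiples_coprime (b * (b * (t * s - d * c3 * d3 * b))).
  exists (t * s * a ^+ 3 + d * ((c1 * a + c2 * b) * (d1 * a ^+ 2 + d2 * (a * b) + d3 * b ^+ 2) +
    c3 * b ^+ 2 * (d1 * a + d2 * b))).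
  apply/eqP; rewrite -subr_eq0; apply/eqP.
  transitivity (t * s * cusp - d * ((c1 * a ^+ 2 + c2 * (a * b) + c3 * b ^+ 2) *
    (d1 * a ^+ 2 + d2 * (a * b) + d3 * b ^+ 2))); first by rewrite /cusp; ring.
  by rewrite -tE -sE cE dE; ring.
have [|e' e'E] := @multiples_coprime (t * s - d * c3 * d3 * b).
  by apply: multiples_coprime; exists e.
rewrite -[t * s](subrK (d * c3 * d3 * b)) e'E.
by apply: idealD => //; apply: idealMl.
Qed.

End CuspFactor.

(* Over the fraction field, nonzero primes of a polynomial ring are maximal. *)
Lemma prime_over_zero (R : idomainType) (Q1 Q2 : {poly R} -> Prop) (h : {poly R}) :
  is_prime Q1 -> is_prime Q2 -> subI Q1 Q2 ->
  (forall r, r != 0 -> ~ Q2 r%:P) -> h != 0 -> Q1 h -> subI Q2 Q1.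
Proof.
move=> pr1 pr2 s12 Q20 h0 Q1h; have id2 := prime_ideal pr2.
(* A nonzero [g] of least degree generates [Q2] over the fraction field, by pseudo-division. *)
have [|n /asboolP[g [g0 Q2g sg]] minn] :=
    @ex_minnP (fun n => `[< exists g, [/\ g != 0, Q2 g & size g = n] >]).
  by exists (size h); apply/asboolP; exists h; split=> //; exact: s12.
have lg0 k : lead_coef g ^+ k != 0 by rewrite expf_neq0 // lead_coef_eq0.
have divg q : Q2 q -> exists k d, (lead_coef g ^+ k)%:P * q = d * g.
  move=> Q2q; have := Pdiv.Idomain.divp_eq q g; set k := Pdiv.Idomain.scalp _ _.
  rewrite -mul_polyC => E; exists k, (q %/ g).
  suff r0 : q %% g = 0 by rewrite E r0 addr0.
  apply/eqP; apply: contraT => r0.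
  have : (size g <= size (q %% g)%R)%N.
    rewrite sg; apply: minn; apply/asboolP; exists (q %% g); split=> //.
    apply: (ideal_addKr id2 (x := q %/ g * g)); first exact: idealMl.
    by rewrite -E; exact: idealMl.
  by rewrite leqNgt Pdiv.Idomain.ltn_modp g0.
(* Factors [g] are stripped from [h]; the degree drops as long as the cofactor stays in [Q1], so [g]
   itself must be in [Q1]. *)
have Q1g : Q1 g.
  have [m] := ubnP (size h); elim: m h h0 Q1h => // m IHm h h0 Q1h; rewrite ltnS => sh.
  have [k [d E]] := divg h (s12 _ Q1h).
  have d0 : d != 0.
    apply/eqP => d0; move/eqP: E; rewrite d0 mul0r mulf_eq0 (negPf h0) orbF.
    by rewrite polyC_eq0 (negPf (lg0 k)).
  have [Q1d|//] : Q1 d \/ Q1 g.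
    by apply: (primeM pr1); rewrite -E; apply: idealMl => //; exact: prime_ideal.
  apply: (IHm d) => //; apply: leq_trans sh.
  have -> : size h = size (d * g) by rewrite -E mul_polyC size_scale.
  rewrite size_mul //.
  have : (1 < size g)%N.
    rewrite ltnNge; apply/negP => /size1_polyC gE.
    by apply: (Q20 g`_0); [apply: contra_neq g0 => c0; rewrite gE c0|rewrite -gE].
  by case: (size g) => [|[|s]] // _; rewrite !addnS /= ltnS leq_addr.
move=> q Q2q; have [k [d E]] := divg q Q2q.
have nlc : ~ Q1 (lead_coef g ^+ k)%:P by move=> /s12/Q20; apply.
by apply: (primeMl pr1 nlc); rewrite E; apply: idealMl => //; exact: prime_ideal.
Qed.

(** * The prime of the curve [X = e / a] over [R/p], and its height *)

Section CurvePrime.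
Variables (R : idomainType) (p a e : R).
Hypotheses (ufdR : is_ufd R) (prp : prime_elt p) (npa : ~ multiples p a).
Let prpI := prime_elt_prime prp.
Let idp : is_ideal (multiples p) := multiples_ideal p.

Definition curve_eval (h : {poly R}) : {fraction R} :=
  (map_poly (@tofrac R) h).[tofrac e / tofrac a].

(** The kernel of [R[X] -> Frac(R/p)], [X |-> e / a]. Since [p] does not divide [a], values lie in
    the local ring of [R] at [(p)], and the kernel consists of those with value in its maximal
    ideal. *)
Definition curve_ideal (h : {poly R}) :=
  exists x y, ~ multiples p y /\ tofrac y * curve_eval h = tofrac (x * p).

Lemma curve_evalD g h : curve_eval (g + h) = curve_eval g + curve_eval h.
Proof. by rewrite /curve_eval rmorphD hornerD. Qed.
Lemma curve_evalM g h : curve_eval (g * h) = curve_eval g * curve_eval h.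
Proof. by rewrite /curve_eval rmorphM hornerM. Qed.
Lemma curve_evalN h : curve_eval (- h) = - curve_eval h.
Proof. by rewrite /curve_eval rmorphN hornerN. Qed.
Lemma curve_evalC c : curve_eval c%:P = tofrac c.
Proof. by rewrite /curve_eval map_polyC hornerC. Qed.
Lemma curve_evalX : curve_eval 'X = tofrac e / tofrac a.
Proof. by rewrite /curve_eval map_polyX hornerX. Qed.
Lemma curve_evalXa : tofrac a * curve_eval 'X = tofrac e.
Proof.
rewrite curve_evalX mulrC divfK // tofrac_eq0.
by apply/eqP => a0; apply: npa; rewrite a0; exists 0; rewrite mul0r.
Qed.

Lemma curve_eval_integral h : exists x y, ~ multiples p y /\ tofrac y * curve_eval h = tofrac x.
Proof.
elim/poly_ind: h => [|h c [x [y [ny E]]]].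
  by exists 0, 1; rewrite -polyC0 curve_evalC tofrac0 mulr0; split=> //; exact: prime1.
exists (x * e + y * a * c), (y * a); split; first exact: primeNM.
by rewrite curve_evalD curve_evalM curve_evalC !(tofracD, tofracM) -E -curve_evalXa; ring.
Qed.

Lemma tofracI (x y : R) : tofrac x = tofrac y -> x = y.
Proof. by move/eqP; rewrite tofrac_eq => /eqP. Qed.

Lemma curve_idealC c : curve_ideal c%:P <-> multiples p c.
Proof.
split=> [[x [y [ny]]]|[x ->]].
  rewrite curve_evalC -tofracM => /tofracI E.
  by apply: (primeMl prpI ny); exists x.
by exists x, 1; rewrite curve_evalC tofrac1 mul1r; split=> //; exact: prime1.
Qed.

Lemma curve_ideal_prime : is_prime curve_ideal.
Proof.
split.
  split; first by apply/curve_idealC; exact: ideal0.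
  split=> [g h [x [y [ny E]]] [x' [y' [ny' E']]]|g h [x [y [ny E]]]].
    exists (y' * x + y * x'), (y * y'); split; first exact: primeNM.
    rewrite curve_evalD tofracM.
    transitivity (tofrac y' * (tofrac y * curve_eval g) +
      tofrac y * (tofrac y' * curve_eval h)); first by ring.
    by rewrite E E' !(tofracD, tofracM); ring.
  have [x' [y' [ny' E']]] := curve_eval_integral g.
  exists (x' * x), (y' * y); split; first exact: primeNM.
  rewrite curve_evalM tofracM.
  transitivity ((tofrac y' * curve_eval g) * (tofrac y * curve_eval h)); first by ring.
  by rewrite E E' !tofracM; ring.
split=> [|g h [x [y [ny E]]]].
  by rewrite -[1]/(1%:P) curve_idealC; exact: prime1.
have [x1 [y1 [ny1 E1]]] := curve_eval_integral g.
have [x2 [y2 [ny2 E2]]] := curve_eval_integral h.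
have : multiples p (y * (x1 * x2)).
  exists (y1 * y2 * x); apply: tofracI.
  rewrite !tofracM -E1 -E2.
  transitivity (tofrac y1 * tofrac y2 * (tofrac y * curve_eval (g * h))).
    by rewrite curve_evalM; ring.
  by rewrite E tofracM; ring.
move=> /(primeMl prpI ny)/(primeM prpI)[[c cE]|[c cE]]; [left|right].
  by exists c, y1; rewrite -cE.
by exists c, y2; rewrite -cE.
Qed.

Let prP := curve_ideal_prime.
Let idP := prime_ideal prP.

Lemma curve_ideal_line : curve_ideal (a%:P * 'X - e%:P).
Proof.
exists 0, 1; split; first exact: prime1.
rewrite curve_evalD curve_evalN curve_evalM !curve_evalC curve_evalXa.
by rewrite subrr mul0r mulr0 tofrac0.
Qed.

(** Pseudo-division by [a X - e]; the bound on the size of the quotient serves the induction in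
    [below_curve_piX]. *)
Lemma curve_reduction n (h : {poly R}) : (size h <= n.+1)%N ->
  exists (k : nat) (q : {poly R}) (r : R),
  (size q <= n)%N /\ (a ^+ k)%:P * h = (a%:P * 'X - e%:P) * q + r%:P.
Proof.
elim: n h => [|n IHn] h sh.
  exists 0%N, 0, h`_0; rewrite size_poly0; split=> //.
  by rewrite mulr0 add0r mul1r; exact: size1_polyC.
have [g hE] := poly_cons_coef0 h.
have sg : (size g <= n.+1)%N.
  have [->|g0] := eqVneq g 0; first by rewrite size_poly0.
  by move: sh; rewrite hE size_MXaddC (negPf g0).
have [k [q [r [sq E]]]] := IHn _ sg.
exists k.+1, (a%:P * q * 'X + r%:P), (r * e + a ^+ k.+1 * h`_0); split.
  rewrite size_MXaddC; case: ifP => // _; rewrite ltnS.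
  by rewrite mul_polyC; apply: leq_trans (size_scale_leq _ _) sq.
rewrite {1}hE.
transitivity (a%:P * 'X * ((a ^+ k)%:P * g) + (a ^+ k.+1 * h`_0)%:P).
  by rewrite exprS !polyCM; ring.
by rewrite E !(polyCD, polyCM); ring.
Qed.

Let piX := poly_ideal (multiples p).
Let prpiX : is_prime piX := poly_ideal_prime prpI.

Lemma line_notin_piX : ~ piX (a%:P * 'X - e%:P).
Proof.
by move=> /(_ 1%N); rewrite coefB coefCM coefX coefC mulr1 subr0.
Qed.

Section Below.
Variable Q : {poly R} -> Prop.
Hypotheses (prQ : is_prime Q) (QP : subI Q curve_ideal).
Let idQ := prime_ideal prQ.

Lemma below_curve_aX k : ~ Q (a ^+ k)%:P.
Proof. by move=> /QP/curve_idealC/(primeX prpI). Qed.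

(** [Q] omits the line [a X - e], for the line and [p] would pull all of the curve ideal into [Q].
    Pseudo-division of an element of [Q] by the line has remainder in [(p)], so the quotient is
    again in [Q] and induction on the size applies. *)
Lemma below_curve_piX : ~ subI curve_ideal Q -> Q p%:P -> subI Q piX.
Proof.
move=> PQ Qp.
have QC r : curve_ideal r%:P -> Q r%:P.
  by move=> /curve_idealC[c ->]; rewrite polyCM; exact: idealMl.
have red h n : curve_ideal h -> (size h <= n.+1)%N ->
    exists (k : nat) (q : {poly R}) (r : R), [/\ (size q <= n)%N,
    (a ^+ k)%:P * h = (a%:P * 'X - e%:P) * q + r%:P & curve_ideal r%:P].
  move=> Ph /curve_reduction[k [q [r [sq E]]]]; exists k, q, r; split=> //.
  apply: (ideal_addKr idP (x := (a%:P * 'X - e%:P) * q)); last by rewrite -E; exact: idealMl.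
  by apply: idealMr => //; exact: curve_ideal_line.
have nQline : ~ Q (a%:P * 'X - e%:P).
  move=> Ql; apply: PQ => h Ph; have [k [q [r [_ E /QC Qr]]]] := red h _ Ph (leqnSn _).
  apply: (primeMl prQ (below_curve_aX (k := k))); rewrite E.
  by apply: idealD => //; exact: idealMr.
move=> h; have [n] := ubnP (size h); elim: n h => // n IHn h; rewrite ltnS.
case: n IHn => [_|n IHn] sh Qh.
  by move: sh; rewrite leqn0 size_poly_eq0 => /eqP ->; exact: (ideal0 (prime_ideal prpiX)).
have [k [q [r [sq E Pr]]]] := red h n (QP Qh) sh.
have Qq : Q q.
  apply: (primeMl prQ nQline); apply: (ideal_addKr idQ (QC _ Pr)).
  by rewrite addrC -E; exact: idealMl.
have piXa : ~ piX (a ^+ k)%:P by move=> /(poly_idealC _ idp)/(primeX prpI).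
apply: (primeMl prpiX piXa); rewrite E; apply: (idealD (prime_ideal prpiX)).
  by apply: (idealMl (prime_ideal prpiX)); exact: IHn.
by apply/(poly_idealC _ idp)/curve_idealC.
Qed.

(** The prime [(p)[X]] has height one: dividing [h] by [p] inside [Q] must stop, since the leading
    coefficient has finite order at [p]. *)
Lemma piX_below (h : {poly R}) : subI Q piX -> h != 0 -> Q h -> Q p%:P.
Proof.
move=> Qpi h0 Qh; have p0 := prp.1.
have lc0 : lead_coef h != 0 by rewrite lead_coef_eq0.
have [m [r [nr rE]]] := prime_elt_valuation ufdR prp lc0.
elim: m h Qh rE {h0 lc0} => [|m IHm] h Qh rE.
  by case: nr; rewrite mulr1 in rE; rewrite -rE; exact: Qpi.
have /multiples_poly[g gE] := Qpi _ Qh.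
have : Q (g * p%:P) by rewrite -gE.
move=> /(primeM prQ)[Qg|//]; apply: (IHm g Qg).
apply: (mulIf p0); rewrite -mulrA -exprSr -rE gE.
by rewrite lead_coefM lead_coefC.
Qed.

Lemma below_curve_const r : ~ Q p%:P -> r != 0 -> ~ Q r%:P.
Proof.
move=> nQp r0 Qr; have [m [s [ns rE]]] := prime_elt_valuation ufdR prp r0.
move: Qr; rewrite rE polyCM => /(primeM prQ)[/QP/curve_idealC//|].
by rewrite polyC_exp => /(primeX prQ).
Qed.

End Below.

(** In a chain [f 0 < f 1 < f 2 < P], if [f 2] contains [p] it lies in [(p)[X]], and so does the
    nonzero prime [f 1], which then equals it. Otherwise [f 2] has no nonzero constant, and [f 1] is
    already maximal over the fraction field. *)
Lemma curve_ideal_height : ~ ht_ge curve_ideal 3.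
Proof.
move=> /(_ _ prP (fun _ => id))[f [prf [lt f3]]].
have pr1 := prf 1%N isT; have pr2 := prf 2%N isT.
have [s01 n10] := lt 0%N isT; have [s12 n21] := lt 1%N isT; have [s23 n32] := lt 2%N isT.
have s2P : subI (f 2%N) curve_ideal by move=> h /s23/f3.
have nP2 : ~ subI curve_ideal (f 2%N) by move=> s; apply: n32 => h /f3/s.
have [h [h1 h0]] : exists h, f 1%N h /\ h != 0.
  apply: contrapT => /forallNP nex; apply: n10 => h h1.
  have [->|h0] := eqVneq h 0; last by case: (nex h).
  exact: (ideal0 (prime_ideal (prf 0%N isT))).
have [f2p|nf2p] := pselect (f 2%N p%:P).
  have s2pi := below_curve_piX pr2 s2P nP2 f2p.
  have s1pi : subI (f 1%N) piX by move=> g /s12/s2pi.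
  have f1p := piX_below pr1 s1pi h0 h1.
  apply: n21 => g /s2pi/multiples_poly[c ->].
  exact: (idealMl (prime_ideal pr1)).
apply: n21; apply: (prime_over_zero pr1 pr2 s12 _ h0 h1) => r.
exact: below_curve_const.
Qed.

End CurvePrime.

(** * A maximal ideal that is the radical of two elements *)

Lemma zero_prime (R : idomainType) : is_prime (fun x : R => x = 0).
Proof.
split.
  by split=> //; split=> [x y -> ->|a x ->]; rewrite ?addr0 ?mulr0.
split=> [/eqP|x y /eqP]; first by rewrite oner_eq0.
by rewrite mulf_eq0 => /orP[/eqP|/eqP]; [left|right].
Qed.

Lemma prime_chain_to3 (S : comNzRingType) (Q0 Q1 Q2 Q : S -> Prop) :
  is_prime Q0 -> is_prime Q1 -> is_prime Q2 -> is_prime Q ->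
  subI Q0 Q1 -> ~ subI Q1 Q0 -> subI Q1 Q2 -> ~ subI Q2 Q1 -> subI Q2 Q -> ~ subI Q Q2 ->
  prime_chain_to Q 3.
Proof.
move=> pr0 pr1 pr2 pr3 s01 n10 s12 n21 s23 n32.
exists (fun i => match i with 0 => Q0 | 1 => Q1 | 2 => Q2 | _ => Q end).
split; first by case=> [|[|[]]].
by split=> //; case=> [|[|[|]]].
Qed.

(** Chinese remaindering: [m] is 0 modulo [M] and 1 modulo every other maximal ideal in the list. *)
Lemma maximal_avoidance (R : comNzRingType) (M : R -> Prop) (l : seq (R -> Prop)) :
  is_maximal M -> exists2 m, M m & forall M', is_maximal M' -> ~ eqI M' M ->
    (exists2 i, (i < size l)%N & eqI M' (nth (fun=> False) l i)) -> M' (1 - m).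
Proof.
move=> mM; have [idM [nM1 maxM]] := mM; elim: l => [|I l [m Mm mP]].
  by exists 0; [exact: ideal0|move=> M' _ _ []].
have [[M1 [mM1 [nM1M M1I]]]|noM1] :=
    pselect (exists M1, is_maximal M1 /\ ~ eqI M1 M /\ eqI M1 I); last first.
  exists m => // M' mM' nM' [[|i] il E]; last by apply: mP => //; exists i.
  by case: noM1; exists M'.
have [idM1 [nM11 maxM1]] := mM1.
have [x Mx nM1x] : exists2 x, M x & ~ M1 x.
  apply: contrapT => nex; have MM1 : subI M M1.
    by move=> x Mx; apply: contrapT => nM1x; apply: nex; exists x.
  by case: (maxM M1 idM1 MM1).
have [EM1|[i [c [M1i E1]]]] := maxM1 _ (adjoin_ideal x idM1) (@adjoin_sub _ M1 x).
  by case: nM1x; apply/EM1/adjoin_mem.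
(* This is [1 - (1 - m) * (1 - c * x)], where [c * x] is in [M] and is 1 modulo [M1]. *)
exists (m + c * x - m * (c * x)).
  apply: idealB => //; last by apply: idealMr.
  by apply: idealD => //; apply: idealMl.
move=> M' mM' nM'.
have -> : 1 - (m + c * x - m * (c * x)) = (1 - m) * (1 - c * x) by ring.
have idM' : is_ideal M' by case: mM'.
case=> -[|k] kl E.
  apply: idealMl => //; apply/E/M1I.
  by rewrite E1 addrK.
by apply: idealMr => //; apply: mP => //; exists k.
Qed.

(** By finite character [y] can be chosen so that [M] is the only maximal ideal containing [p] and
    [y]. A smaller prime over [(p, y)] would then sit in a chain of length three from 0 through
    [(p)] to [M]. *)
Lemma exists_two_gen_maximal (R : idomainType) :
  is_ufd R -> finite_character R -> krull_dim_is R 2 -> exists (M : R -> Prop) (p y : R),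
  [/\ is_prime M, prime_elt p, M p, M y & ~ multiples p y /\
    forall x, M x -> exists n, span2 p y (x ^+ n)].
Proof.
move=> ufdR fcR [[Q [f [prf [lt _]]]] nchain3].
have pr1 := prf 1%N isT; have pr2 := prf 2%N isT.
have [s01 n10] := lt 0%N isT; have [s12 n21] := lt 1%N isT.
have [M mM s2M] := exists_maximal (prime_ideal pr2) (prime1 pr2).
have prM := maximal_prime mM; have idM := prime_ideal prM.
have [x [x1 x0]] : exists x, f 1%N x /\ x != 0.
  apply: contrapT => /forallNP nex; apply: n10 => x x1.
  have [->|x0] := eqVneq x 0; first exact: (ideal0 (prime_ideal (prf 0%N isT))).
  by case: (nex x).
have [p [prp p1 _]] := exists_prime_elt ufdR pr1 x1 x0.
have [p0 prpI] := prp; have idp := multiples_ideal p.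
have Mp : M p by exact/s2M/s12.
have [y0 My0 npy0] : exists2 y, M y & ~ multiples p y.
  apply: contrapT => nex; apply: n21 => y y2; apply: contrapT => ny1.
  apply: nex; exists y; first exact: s2M.
  by move=> /(multiples_min (prime_ideal pr1) p1).
have [l lP] := fcR p p0; have [m Mm mP] := maximal_avoidance l mM.
have [y [My npy onlyM]] : exists y, [/\ M y, ~ multiples p y &
    forall M', is_maximal M' -> M' p -> M' y -> eqI M' M].
  have key M' : is_maximal M' -> M' p -> M' m -> eqI M' M.
    move=> mM' M'p M'm; apply: contrapT => nM'.
    have [idM' [nM'1 _]] := mM'; apply: nM'1.
    by rewrite -[1](subrK m); apply: idealD => //; apply: mP => //; exact: lP.
  (* If [p] divides [m], then [M] is the only maximal ideal containing [p], and any [y0] of [M]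
     outside [(p)] will do. *)
  have [pm|npm] := pselect (multiples p m); last by exists m.
  exists y0; split=> // M' mM' M'p _; apply: key => //.
  by apply: (multiples_min _ M'p pm); case: mM'.
exists M, p, y; split=> //; split=> // z Mz; apply: contrapT => nz.
have [[n zn]|Q' [prQ' pyQ' nQ'z]] := exists_prime_avoiding (x := z) (span2_ideal p y).
  by apply: nz; exists n.
have Q'p : Q' p by apply: pyQ'; exact: span2l.
have Q'y : Q' y by apply: pyQ'; exact: span2r.
have [M' mM' Q'M'] := exists_maximal (prime_ideal prQ') (prime1 prQ').
have EM := onlyM M' mM' (Q'M' _ Q'p) (Q'M' _ Q'y).
apply: nchain3; exists M.
apply: (@prime_chain_to3 _ (fun x => x = 0) (multiples p) Q') => //.
- exact: zero_prime.
- by move=> _ ->; exact: ideal0.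
- by move=> /(_ p (multiples_refl p)) /eqP; rewrite (negPf p0).
- exact: (multiples_min (prime_ideal prQ') Q'p).
- by move=> /(_ y Q'y)/npy.
- by move=> t /Q'M'/EM.
- by move=> /(_ z Mz)/nQ'z.
Qed.

(** * Height and coprimality in [R[X]] *)

Section HeightTwo.
Variables (R : idomainType) (p : R).
Hypothesis prp : prime_elt p.

Lemma multiples_polyE : multiples p%:P = poly_ideal (multiples p).
Proof. by rewrite predeqE => h; exact: multiples_poly. Qed.

Lemma prime_eltC : prime_elt p%:P.
Proof.
have [p0 prpI] := prp; split; first by rewrite polyC_eq0.
by rewrite multiples_polyE; exact: poly_ideal_prime.
Qed.

Lemma ht_ge2 (P : {poly R} -> Prop) h : P p%:P -> P h -> ~ multiples p%:P h -> ht_ge P 2.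
Proof.
have [p0 prpI] := prime_eltC.
move=> Pp Ph nph Q prQ PQ; apply: (@prime_chain_to2 _ (fun x => x = 0) (multiples p%:P)) => //.
- exact: zero_prime.
- by move=> _ ->; exact: (ideal0 (multiples_ideal _)).
- by move=> /(_ _ (multiples_refl _))/eqP; rewrite (negPf p0).
- by apply: multiples_min; [exact: prime_ideal|exact: PQ].
- by move=> /(_ h (PQ _ Ph))/nph.
Qed.

(** Powers of [p] and [L] in [(f, g)] give [p ^+ n * u = g * e] and [L ^+ m * u = g * e']. Hence
    [e * L ^+ m = e' * p ^+ n], so [p ^+ n] divides [e], and the quotient is the multiplier [c]. *)
Lemma coprime_of_powers (f g L : {poly R}) : ~ multiples p%:P L ->
  (exists n, span2 f g (p%:P ^+ n)) -> (exists n, span2 f g (L ^+ n)) ->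
  forall u v, f * u = g * v -> exists c, u = g * c /\ v = f * c.
Proof.
move=> npL [n [x [y En]]] [m [x' [y' Em]]] u v fugv.
have pn0 : p%:P ^+ n != 0 by rewrite expf_neq0 //; case: prime_eltC.
pose e := x * v + y * u; pose e' := x' * v + y' * u.
have E1 : p%:P ^+ n * u = g * e.
  by rewrite En mulrDl /e mulrDr -!mulrA fugv; ring.
have E2 : p%:P ^+ n * v = f * e.
  transitivity (x * f * v + y * (g * v)); first by rewrite En; ring.
  by rewrite -fugv /e; ring.
have E1' : L ^+ m * u = g * e'.
  by rewrite Em mulrDl /e' mulrDr -!mulrA fugv; ring.
have E2' : L ^+ m * v = f * e'.
  transitivity (x' * f * v + y' * (g * v)); first by rewrite Em; ring.
  by rewrite -fugv /e'; ring.
have K : e * L ^+ m = e' * p%:P ^+ n.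
  have gK : g * (e * L ^+ m - e' * p%:P ^+ n) = 0.
    by rewrite mulrBr !mulrA -E1 -E1'; ring.
  have fK : f * (e * L ^+ m - e' * p%:P ^+ n) = 0.
    by rewrite mulrBr !mulrA -E2 -E2'; ring.
  apply/eqP; rewrite -subr_eq0.
  have [g0|g0] := eqVneq g 0; last by move/eqP: gK; rewrite mulf_eq0 (negPf g0).
  have [f0|f0] := eqVneq f 0; last by move/eqP: fK; rewrite mulf_eq0 (negPf f0).
  by move: pn0; rewrite En f0 g0 !mulr0 addr0 eqxx.
have [||c cE] := @prime_eltX_dvd _ p%:P n e (L ^+ m) prime_eltC.
- by apply: prime_NX npL; case: prime_eltC.
- by exists e'.
by exists c; split; apply: (mulfI pn0); rewrite ?E1 ?E2 cE; ring.
Qed.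

End HeightTwo.

(** * Local generation of the curve prime at [(M, X)] *)

Section CurveGenerators.
Variables (R : idomainType) (M : R -> Prop) (a b p c : R).
Hypotheses (prM : is_prime M) (pra : prime_elt a) (prb : prime_elt b).
Hypotheses (Ma : M a) (Mb : M b) (nab : ~ multiples a b).
Hypothesis Mab : forall m, M m -> loc M (span2 a b) m.
Hypotheses (prp : prime_elt p) (nMc : ~ M c) (npa : ~ multiples p a).
Hypothesis cuspE : b ^+ 3 - a ^+ 4 = c * p.
Let idM := prime_ideal prM.
Let P := curve_ideal p a (b ^+ 2).
Let idP := prime_ideal (curve_ideal_prime (b ^+ 2) prp npa).
Let idM2 : is_ideal (local_square M a b) := local_square_ideal prM a b.

Lemma curve_ideal_b_line : P (b%:P * 'X - (a ^+ 3)%:P).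
Proof.
(* On the curve [a X = b ^+ 2], so multiplying the value by [a] gives [b ^+ 3 - a ^+ 4 = c * p]. *)
exists c, a; split=> //.
rewrite curve_evalD curve_evalN curve_evalM !curve_evalC.
transitivity (tofrac b * (tofrac a * curve_eval a (b ^+ 2) 'X) -
  tofrac a * tofrac (a ^+ 3)); first by ring.
rewrite (curve_evalXa (b ^+ 2) npa) -cuspE.
by rewrite tofracB !tofracXn; ring.
Qed.

Lemma curve_ideal_quadric : P ('X^2 - (a ^+ 2 * b)%:P).
Proof.
(* Multiplied by [a ^+ 2] the value is [b ^+ 4 - a ^+ 4 * b = b * c * p]. *)
exists (b * c), (a ^+ 2); split; first exact: (prime_NX (prime_elt_prime prp)).
rewrite curve_evalD curve_evalN expr2 curve_evalM !curve_evalC.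
transitivity ((tofrac a * curve_eval a (b ^+ 2) 'X) ^+ 2 - tofrac (a ^+ 2) * tofrac (a ^+ 2 * b)).
  by rewrite !(tofracXn, tofracM); ring.
rewrite (curve_evalXa (b ^+ 2) npa) -mulrA -cuspE.
by rewrite !(tofracXn, tofracB, tofracM); ring.
Qed.

Lemma quadric_reduction (h : {poly R}) (d : R) :
  exists k g0 g1, h = k * ('X^2 - d%:P) + (g1%:P * 'X + g0%:P).
Proof.
elim/poly_ind: h => [|h e [k [g0 [g1 ->]]]].
  by exists 0, 0, 0; rewrite !mul0r !addr0.
exists (k * 'X + g1%:P), (g1 * d + e), g0.
by rewrite polyCD polyCM; ring.
Qed.

(* Each element of [P] vanishes to order two at [(M, 'X)]. *)
Lemma curve_ideal_coef h : P h -> local_square M a b h`_0 /\ M h`_1.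
Proof.
have M2d : local_square M a b (a ^+ 2 * b).
  by rewrite expr2 -mulrA; apply: idealMl => //; exact: local_squareM.
have Md := local_square_sub prM Ma Mb M2d.
have [k [g0 [g1 hE]]] := quadric_reduction h (a ^+ 2 * b) => Ph.
have : P (g1%:P * 'X + g0%:P).
  apply: (ideal_addKr idP (x := k * ('X^2 - (a ^+ 2 * b)%:P))); last by rewrite -hE.
  by apply: (idealMl idP); exact: curve_ideal_quadric.
case=> x [y [npy]]; rewrite curve_evalD curve_evalM !curve_evalC => E.
have [r rE] : multiples p (g1 * b ^+ 2 + g0 * a).
  apply: (primeMl (prime_elt_prime prp) npy); exists (x * a); apply: tofracI.
  transitivity (tofrac a * tofrac (x * p)); last by rewrite !tofracM; ring.
  by rewrite -E tofracM tofracD tofracM -(curve_evalXa (b ^+ 2) npa) tofracM; ring.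
have rE' : c * (g1 * b ^+ 2 + g0 * a) = r * (b ^+ 3 - a ^+ 4).
  by rewrite rE cuspE; ring.
(* Comparing terms, [a] divides [c * g1 - r * b], say with quotient [s]. Then
   [c * g1 = s * a + r * b] is in [M] and [c * g0 = - r * a ^+ 3 - s * b ^+ 2] in its square. *)
have [|s sE] := multiples_coprime pra nab (u := c * g1 - r * b).
  apply: (multiples_coprime pra nab); exists (- (c * g0 + r * a ^+ 3)).
  apply/eqP; rewrite -subr_eq0; apply/eqP.
  transitivity (c * (g1 * b ^+ 2 + g0 * a) - r * (b ^+ 3 - a ^+ 4)); first by ring.
  by rewrite rE' subrr.
have Mg1 : M g1.
  apply: (primeMl prM nMc); rewrite -[c * g1](subrK (r * b)) sE.
  by apply: idealD => //; exact: idealMl.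
have M2g0 : local_square M a b g0.
  apply: (loc_cancel prM nMc).
  have -> : c * g0 = - (r * a) * (a * a) + - s * (b * b).
    apply: (mulfI (proj1 pra)).
    transitivity (c * (g1 * b ^+ 2 + g0 * a) - b ^+ 2 * (c * g1 - r * b) - r * b ^+ 3);
      first by ring.
    by rewrite rE' sE; ring.
  by apply: idealD => //; apply: idealMl => //; exact: local_squareM.
rewrite hE mulrBr !coefD !coefN coefMXn !coefMC coefMXn coefMX !coefC coefMX coefC /=.
rewrite !add0r addr0; split; last by apply: idealD => //; apply: idealN => //; exact: idealMl.
by apply: idealD => //; apply: idealN => //; exact: idealMl.
Qed.

Definition const_in (h : {poly R}) := M h`_0.

Lemma const_in_prime : is_prime const_in.
Proof.
rewrite /const_in; split.
  split; first by rewrite coef0; exact: ideal0.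
  split=> [g h Mg Mh|g h Mh]; first by rewrite coefD; exact: idealD.
  by rewrite coef0M; exact: idealMl.
split=> [|g h]; first by rewrite coef1; exact: prime1.
by rewrite coef0M => /(primeM prM).
Qed.

Lemma coef_mul_line (w : {poly R}) x y i :
  (w * (x%:P * 'X - y%:P))`_i.+1 = w`_i * x - w`_i.+1 * y.
Proof. by rewrite mulrBr mulrA coefB coefMX !coefMC. Qed.

Variables f g : {poly R}.
Hypotheses (Pf : P f) (Pg : P g).

(* [P] is not generated by [f] and [g] near [(M, 'X)]: its three quadrics are
   independent modulo the cube of this ideal. *)
Lemma curve_ideal_not_two_gen : ~ (forall h, P h -> loc const_in (span2 f g) h).
Proof.
move=> Ploc; have prN := const_in_prime.
have [s1 n1 [u1 [v1 E1]]] := Ploc _ (curve_ideal_line (b ^+ 2) prp npa).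
have [s2 n2 [u2 [v2 E2]]] := Ploc _ curve_ideal_b_line.
have [s3 n3 [u3 [v3 E3]]] := Ploc _ curve_ideal_quadric.
(* A combination of the quadrics, nontrivial modulo [N], equals [U * f + V * g] with [U], [V] in
   [N]; since [f], [g] have order two, it has order three. *)
have [w1 [w2 [w3 [nw NU NV]]]] := exists_relation_mod_prime u1 u2 u3 v1 v2 v3 prN.
set U := w1 * u1 + _ + _ in NU; set V := w1 * v1 + _ + _ in NV.
have [M2f0 Mf1] := curve_ideal_coef Pf; have [M2g0 Mg1] := curve_ideal_coef Pg.
have M2M x : local_square M a b x -> M x by exact: local_square_sub.
have E : (w1 * s1) * (a%:P * 'X - (b ^+ 2)%:P) + (w2 * s2) * (b%:P * 'X - (a ^+ 3)%:P) +
    (w3 * s3) * ('X^2 - (a ^+ 2 * b)%:P) = U * f + V * g.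
  by rewrite -mulrA E1 -mulrA E2 -(mulrA w3) E3 /U /V; ring.
have coef1 (A h : {poly R}) : M A`_0 -> local_square M a b h`_0 -> M h`_1 ->
    local_square M a b (A * h)`_1.
  move=> MA M2h Mh; rewrite coefM !big_ord_recl big_ord0 addr0.
  apply: idealD => //; first exact: local_squareM.
  by apply: (idealMl idM2).
have coef2 (A h : {poly R}) : M A`_0 -> local_square M a b h`_0 -> M h`_1 ->
    M (A * h)`_2.
  move=> MA M2h Mh; rewrite coefM !big_ord_recl big_ord0 addr0.
  apply: idealD => //; first exact: (idealMr idM).
  by apply: idealD => //; apply: (idealMl idM) => //; exact: M2M.
have M2a x : local_square M a b (x * a ^+ 2).
  by apply: (idealMl idM2); rewrite expr2; exact: local_squareM.
have M2b x : local_square M a b (x * b ^+ 2).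
  by apply: (idealMl idM2); rewrite expr2; exact: local_squareM.
(* The coefficient of [X], modulo the square of [M], is a combination of [a] and [b]. *)
have [Mw1 Mw2] : M (w1 * s1)`_0 /\ M (w2 * s2)`_0.
  apply: (local_square_independent prM pra prb Ma Mb nab).
  have : local_square M a b (U * f + V * g)`_1.
    by rewrite coefD; apply: (idealD idM2); exact: coef1.
  rewrite -E !coefD !coef_mul_line mulrBr coefB coefMXn coefMC /= sub0r => H.
  rewrite -[X in local_square _ _ _ X](subrK ((w1 * s1)`_1 * b ^+ 2 +
    ((w2 * s2)`_1 * a) * a ^+ 2 + ((w3 * s3)`_1 * b) * a ^+ 2)).
  apply: (idealD idM2).
    by apply: (eq_rect _ (local_square M a b) H); ring.
  by do 2?apply: (idealD idM2).
(* The coefficient of [X^2], modulo [M], isolates the third quadric. *)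
have Mw3 : M (w3 * s3)`_0.
  have : M (U * f + V * g)`_2.
    by rewrite coefD; apply: (idealD idM); exact: coef2.
  rewrite -E !coefD !coef_mul_line mulrBr coefB coefMXn coefMC /= => H.
  have Ma' x k : M (x * a ^+ k.+1) by apply: (idealMl idM); rewrite exprS; exact: idealMr.
  have Mb' x k : M (x * b ^+ k.+1) by apply: (idealMl idM); rewrite exprS; exact: idealMr.
  apply: (ideal_addKr idM (x := (w1 * s1)`_1 * a ^+ 1 - (w1 * s1)`_2 * b ^+ 2 +
    ((w2 * s2)`_1 * b ^+ 1 - (w2 * s2)`_2 * a ^+ 3) - ((w3 * s3)`_2 * b) * a ^+ 2)).
    apply: (idealB idM) => //; apply: (idealD idM); exact: idealB.
  by apply: (eq_rect _ M H); rewrite !expr1; ring.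
apply: nw; split; [|split].
- by move: Mw1; rewrite coef0M => /(primeM prM)[|/n1].
- by move: Mw2; rewrite coef0M => /(primeM prM)[|/n2].
- by move: Mw3; rewrite coef0M => /(primeM prM)[|/n3].
Qed.

Hypotheses (radP : forall h, P h -> exists n, span2 f g (h ^+ n))
  (finP : forall h z, P h -> exists n w, span2 f g ((1 - z * w) * (z ^+ n * h))).

(** For [z] in [N], [1 - z * w] is outside [N], so finite length makes powers of [a], [b] and [X]
    carry [h] into [(f, g)] locally. As [f] and [g] are coprime, the quotient has no socle for [a],
    [b], [X], and [h] is itself in [(f, g)] locally. *)
Lemma curve_ideal_loc h : P h -> loc const_in (span2 f g) h.
Proof.
have prN := const_in_prime; move=> Ph.
have line := curve_ideal_line (b ^+ 2) prp npa.
have cop := @coprime_of_powers _ _ prp f g (a%:P * 'X - (b ^+ 2)%:P).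
have power z : const_in z -> exists n, loc const_in (span2 f g) (z ^+ n * h).
  move=> Nz; have [n [w E]] := finP z Ph; exists n, (1 - z * w) => // N1.
  apply: (prime1 prN); rewrite -[1](subrK (z * w)).
  by apply: (idealD (prime_ideal prN)) => //; exact: (idealMr (prime_ideal prN)).
have [|n1 L1] := power a%:P; first by rewrite /const_in coefC.
have [|n2 L2] := power b%:P; first by rewrite /const_in coefC.
have [|n3 L3] := power 'X; first by rewrite /const_in coefX; exact: ideal0.
apply: (loc_of_powers prN (span2_ideal f g) _ L1 L2 L3) => k A1 A2 A3.
apply: (koszul_no_socle _ _ _ A1 A2 A3).
- exact: proj1 pra.
- by move=> u; exact: multiples_coprime.
- apply: cop.
  + by rewrite multiples_polyE; exact: line_notin_piX.
  + by apply: radP; apply/curve_idealC => //; exact: multiples_refl.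
  + exact: radP.
Qed.

End CurveGenerators.

(** * Radical finiteness applied to [M[X]] and then to the curve prime *)

Theorem theorem4p3 (R : idomainType) :
  is_ufd R -> finite_character R -> krull_dim_is R 2 ->
  ~ radically_finite {poly R}.
Proof.
move=> ufdR fcR dimR rfR.
have [M [p0 [y [prM prp0 Mp0 My [npy radM]]]]] := exists_two_gen_maximal ufdR fcR dimR.
have idM := prime_ideal prM; pose Q := poly_ideal M.
have prQ : is_prime Q := poly_ideal_prime prM.
have idQ := prime_ideal prQ.
have QC m : M m -> Q m%:P by move=> Mm; apply/poly_idealC.
(* A prime of [R[X]] over [(p0, y)] contains every coefficient of [h], since each has a power in
   [(p0, y)]. *)
have radQ h : Q h -> exists n, span2 p0%:P y%:P (h ^+ n).
  move=> Qh; apply: contrapT => nrad.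
  have [[n hn]|Q' [prQ' IQ' nQ'h]] := exists_prime_avoiding (x := h) (span2_ideal p0%:P y%:P).
    by apply: nrad; exists n.
  have idQ' := prime_ideal prQ'; apply: nQ'h.
  rewrite -[h]coefK poly_def; apply: (ideal_sum idQ') => i _.
  rewrite -mul_polyC; apply: (idealMr idQ').
  have [n [u [v E]]] := radM _ (Qh i).
  apply: (primeX prQ' (n := n)); rewrite -polyC_exp E polyCD !polyCM.
  by apply: IQ'; exists u%:P, v%:P.
(* The exact height fixes at two the number of generators that radical finiteness supplies. *)
have htQ : ht_is Q 2.
  split; last by apply: (ht_ge_two_gen (rfR _ prQ).1 prQ _ _ radQ); exact: QC.
  apply: (ht_ge2 prp0 (QC _ Mp0) (QC _ My)).
  by rewrite multiples_polyE => /(poly_idealC _ (multiples_ideal p0)).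
have [f [g [Qf Qg _ finQ]]] := radically_finite_two_gen rfR prQ htQ.
have [|a0 [b0 [Ma0 Mb0 Mab0]]] := two_local_gens prM Qf Qg.
  (* Taking [z = X], both [X] and [1 - X * w] lie outside [M[X]], so [f] and [g] generate the
     constants of [M] locally there. *)
  move=> m Mm; have [n [w E]] := finQ m%:P 'X (QC _ Mm).
  exists ((1 - 'X * w) * 'X^n); last by rewrite -mulrA.
  apply: (primeNM prQ).
    by move=> /(_ 0%N); rewrite coefB coef1 coefXM subr0; exact: prime1.
  by apply: (prime_NX prQ) => /(_ 1%N); rewrite coefX; exact: prime1.
have [a [b [pra prb Ma Mb [nab Mab]]]] :=
  two_prime_local_gens ufdR prM prp0 Mp0 My npy Ma0 Mb0 Mab0.
have [p [c [prp Mp nMc cuspE npa]]] := cusp_factorization ufdR prM pra prb Ma Mb nab Mab.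
pose P := curve_ideal p a (b ^+ 2).
have prP : is_prime P := curve_ideal_prime (b ^+ 2) prp npa.
have htP : ht_is P 2.
  split; last exact: curve_ideal_height.
  apply: (ht_ge2 prp (h := a%:P * 'X - (b ^+ 2)%:P)).
  - by apply/curve_idealC => //; exact: multiples_refl.
  - exact: curve_ideal_line.
  - by rewrite multiples_polyE; exact: line_notin_piX.
have [f' [g' [Pf Pg radP finP]]] := radically_finite_two_gen rfR prP htP.
apply: (@curve_ideal_not_two_gen _ M a b p c _ _ _ _ _ _ _ _ _ _ _ f' g') => // h.
exact: (@curve_ideal_loc _ M a b p).
Qed.
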